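(* Let $q\ge 2$ be an integer, let $X$ be a $q$-homogeneous tree with origin $o$, and let $\alpha>1$. Let $K:X\times X\to\mathbb C$ be a kernel and suppose that the integral operator $$\mathcal K f(z)=\sum_{x\in X}K(z,x)f(x)q^{-\alpha|x|},\qquad f\in L^2_\alpha,$$ is bounded on $L^2_\alpha$. Then the following hold. (i) If $$\sup_{v\in X\setminus\{o\}}\ \sup_{x,y\in T_v}\ \sum_{z\in X\setminus T_v}|K(z,x)-K(z,y)|\,q^{-\alpha|z|}<+\infty,$$ then $\mathcal K$ extends to a bounded linear operator from $H^1_\alpha$ to $L^1_\alpha$ and to a bounded linear operator on $L^p_\alpha$ for every $1<p<2$. (ii) Let $K^*(x,y)=\overline{K(y,x)}$ for $(x,y)\in X\times X$. If $$\sup_{v\in X\setminus\{o\}}\ \sup_{x,y\in T_v}\ \sum_{z\in X\setminus T_v}|K^*(z,x)-K^*(z,y)|\,q^{-\alpha|z|}<+\infty,$$ then $\mathcal K$ extends to a bounded linear operator from $L^\infty_\alpha$ to ${\rm BMO}_\alpha$ and to a bounded linear operator on $L^p_\alpha$ for every $2<p<\infty$.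
   Context: Tree. $X$ is a $q$-homogeneous tree ($q\ge2$): a connected, loop-free graph in which every vertex has exactly $q+1$ neighbours; $X$ also denotes its set of vertices, and $d$ is the graph distance. Fix an origin $o\in X$ and put $|x|=d(o,x)$. For $x\ne o$, the predecessor $p(x)$ is the unique neighbour of $x$ with $|p(x)|=|x|-1$. The sector of $x\in X$ is $T_x=\{y\in X: p^\ell(y)=x\text{ for some integer }\ell\ge0\}$ (so $x\in T_x$ and $T_o=X$). Measure. For $\alpha>1$, $\mu_\alpha$ is the (finite) measure on $X$ with $\mu_\alpha(\{x\})=q^{-\alpha|x|}$, and $L^p_\alpha=L^p(X,\mu_\alpha)$ with norm $\|\cdot\|_{p,\alpha}$ (complex-valued functions). Dyadic sets. $\mathcal D=\{\{v\}: v\in X\}\cup\{T_v: v\in X\}$. For a function $f$ and $D\in\mathcal D$, $f_D=\frac1{\mu_\alpha(D)}\sum_{x\in D}f(x)q^{-\alpha|x|}$. Hardy space. A $(1,\infty)$-atom is a function $a$ on $X$ such that either $a$ is the constant function $\mu_\alpha(X)^{-1}$, or there is $D\in\mathcal D$ such that $a$ is supported in $D$, $\|a\|_{\infty,\alpha}\le\mu_\alpha(D)^{-1}$, and $\sum_{x\in D}a(x)q^{-\alpha|x|}=0$. $H^1_\alpha$ is the space of $g\in L^1_\alpha$ of the form $g=\sum_j\lambda_ja_j$ with $a_j$ $(1,\infty)$-atoms and $(\lambda_j)$ a summable sequence of complex numbers; $\|g\|_{H^1_\alpha}$ is the infimum of $\sum_j|\lambda_j|$ over all such representations. BMO. ${\rm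 BMO}_\alpha$ is the space of functions $f:X\to\mathbb C$ with $f\in L^1_\alpha$ and $$\|f\|_{{\rm BMO}_\alpha}=\sup_{D\in\mathcal D}\frac1{\mu_\alpha(D)}\sum_{x\in D}|f(x)-f_D|q^{-\alpha|x|}+\Big|\sum_{x\in X}f(x)q^{-\alpha|x|}\Big|<\infty .$$ *)

(* Defs.v *)
(* Complex scalars are R[i], over an arbitrary R : realType. *)
From HB Require Import structures.
From mathcomp Require Import all_boot all_order all_algebra.
From mathcomp Require Import all_classical all_reals all_analysis.
From mathcomp Require Export complex.

Set Implicit Arguments.
Unset Strict Implicit.
Unset Printing Implicit Defensive.

Import Order.TTheory GRing.Theory Num.Theory.
Import numFieldNormedType.Exports.

Local Open Scope classical_set_scope.
Local Open Scope complex_scope.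
Local Open Scope ring_scope.

Notation cmod := ComplexField.Normc.normc.

Section Tree.
Context {X : choiceType}.
Implicit Types (adj : rel X) (o x y v : X).

(* A repetition-free closed walk with at least three vertices is a circuit. *)
Definition homogeneous_tree (q : nat) adj : Prop :=
  [/\ irreflexive adj, symmetric adj,
      (forall x y, exists2 s, path adj x s & last x s = y),
      (forall s : seq X, (2 < size s)%N -> ~ ucycle adj s)
    & forall x, ([set y | adj x y] #= `I_q.+1)%card].

Definition walk_length adj x y (n : nat) : Prop :=
  exists s, [/\ path adj x s, last x s = y & size s = n].

Definition gdist adj x y : nat :=
  xget 0%N [set n | walk_length adj x y n /\
                    forall m, walk_length adj x y m -> (n <= m)%N].

(* The origin has no predecessor; [predecessor adj o o] takes the default value
   o, so that iterating from any vertex eventually stabilizes at o and [sector]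
   is unaffected by this convention. *)
Definition predecessor adj o x : X :=
  xget x [set y | adj x y /\ gdist adj o x = (gdist adj o y).+1].

Definition sector adj o x : set X :=
  [set y | exists l : nat, iter l (predecessor adj o) y = x].

Definition dyadic adj o : set (set X) :=
  [set D | exists v, D = [set v] \/ D = sector adj o v].

End Tree.

(* The weight w x stands for the mass of the point x.  Since every mass is
   positive, functions need not be identified almost everywhere, and the
   essential supremum is the supremum. *)
Section WeightedSpaces.
Context {R : realType} {X : choiceType}.
Implicit Types (w : X -> R) (f g : X -> R[i]) (S D : set X).
Implicit Types (DD : set (set X)).

Definition tree_weight (q : nat) (adj : rel X) (o : X) (alpha : R) : X -> R :=
  fun x => q%:R `^ (- (alpha * (gdist adj o x)%:R)).

Definition mass w S : \bar R := \esum_(x in S) (w x)%:E.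

(* Unordered sum, meaningful when the family is absolutely summable on S. *)
Definition rsum S (u : X -> R) : R :=
  fine (\esum_(x in S) ((EFin \o u)^\+)%E x)
  - fine (\esum_(x in S) ((EFin \o u)^\-)%E x).

Definition csum S f : R[i] :=
  rsum S (fun x => complex.Re (f x)) +i* rsum S (fun x => complex.Im (f x)).

Definition wsum w S f : R[i] := csum S (fun x => f x * (w x)%:C).

Definition Lpnorm w (p : \bar R) f : \bar R :=
  match p with
  | r%:E => (\esum_(x in [set: X]) (cmod (f x) `^ r * w x)%:E) `^ r^-1
  | +oo => ereal_sup [set (cmod (f x))%:E | x in [set: X]]
  | -oo => 0
  end%E.

Definition Lp w (p : \bar R) : set (X -> R[i]) :=
  [set f | (Lpnorm w p f < +oo)%E].

Definition average w D f : R[i] := ((fine (mass w D))^-1)%:C * wsum w D f.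

Definition atom w DD (a : X -> R[i]) : Prop :=
  (forall x, a x = ((fine (mass w [set: X]))^-1)%:C) \/
  exists2 D, DD D &
    [/\ forall x, ~ D x -> a x = 0,
        (Lpnorm w +oo a <= ((fine (mass w D))^-1)%:E)%E
      & wsum w D a = 0].

(* The series converges to g in the norm of L^1. *)
Definition atomic_decomposition w DD g
    (lam : nat -> R[i]) (a : nat -> X -> R[i]) : Prop :=
  [/\ forall j, atom w DD (a j),
      (\sum_(0 <= j <oo) (cmod (lam j))%:E < +oo)%E
    & (fun n : nat =>
         Lpnorm w 1%E (fun x => g x - \sum_(0 <= j < n) lam j * a j x))
      @ \oo --> 0%E].

Definition H1 w DD : set (X -> R[i]) :=
  [set g | Lp w 1%E g /\ exists lam a, atomic_decomposition w DD g lam a].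

Definition H1norm w DD g : \bar R :=
  ereal_inf [set s | exists lam a, atomic_decomposition w DD g lam a /\
                     s = (\sum_(0 <= j <oo) (cmod (lam j))%:E)%E].

Definition BMOnorm w DD f : \bar R :=
  (ereal_sup [set ((fine (mass w D))^-1)%:E *
                  \esum_(x in D) (cmod (f x - average w D f) * w x)%:E
             | D in DD]
   + (cmod (wsum w [set: X] f))%:E)%E.

Definition BMO w DD : set (X -> R[i]) :=
  [set f | Lp w 1%E f /\ (BMOnorm w DD f < +oo)%E].

Definition bounded_linear_op (U V : set (X -> R[i]))
    (normU normV : (X -> R[i]) -> \bar R)
    (T : (X -> R[i]) -> (X -> R[i])) : Prop :=
  [/\ forall f, U f -> V (T f),
      forall (c : R[i]) f g, U f -> U g ->
        T (fun x => c * f x + g x) = (fun x => c * T f x + T g x)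
    & exists M : R, forall f, U f -> (normV (T f) <= M%:E * normU f)%E].

Definition kernel_op w (K : X -> X -> R[i]) f : X -> R[i] :=
  fun z => wsum w [set: X] (fun x => K z x * f x).

(* The sum defining the operator converges absolutely for every f in L^2, and
   the resulting operator is bounded. *)
Definition kernel_bounded_L2 w (K : X -> X -> R[i]) : Prop :=
  (forall f, Lp w 2%:E f -> forall z,
     summable [set: X] (fun x => (cmod (K z x * f x) * w x)%:E)) /\
  bounded_linear_op (Lp w 2%:E) (Lp w 2%:E) (Lpnorm w 2%:E) (Lpnorm w 2%:E)
    (kernel_op w K).

(* "Extends" is agreement with the operator on L^2 wherever both are defined. *)
Definition extends_bounded w (K : X -> X -> R[i]) (U V : set (X -> R[i]))
    (normU normV : (X -> R[i]) -> \bar R) : Prop :=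
  exists2 T, bounded_linear_op U V normU normV T &
    forall f, U f -> Lp w 2%:E f -> T f = kernel_op w K f.

Definition adjoint_kernel (K : X -> X -> R[i]) : X -> X -> R[i] :=
  fun x y => (K y x)^*.

Definition hormander_constant w (T : X -> set X) (o : X)
    (K : X -> X -> R[i]) : \bar R :=
  ereal_sup [set ereal_sup
      [set (\esum_(z in ~` T v) (cmod (K z xy.1 - K z xy.2) * w z)%:E)%E
      | xy in T v `*` T v]
    | v in ~` [set o]].

End WeightedSpaces.

(* Main.v *)
Require Import Defs.
From mathcomp Require Import all_boot all_order all_algebra.
From mathcomp Require Import all_classical all_reals all_analysis.
From mathcomp Require Import finmap ring lra.

(* The extension is always the kernel operator itself.  In (i), the Hoermander
   condition together with the L^2 bound forces every row K(z, .) to be bounded,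
   so that the defining sum converges absolutely for f in L^1; in (ii), the
   domain is contained in L^2.

   Only two features of the tree are used: sectors are nested or disjoint, and
   the mass of a sector is comparable with the weight of its vertex and with
   the mass of the sector of the parent.  The endpoint estimates split the
   operator into the part near a dyadic set, controlled in L^2, and the far
   part, controlled by the Hoermander condition.

   For 1 < p < 2, the kernel is first truncated to a finite set of vertices
   closed under predecessors.  There, the Calderon-Zygmund decomposition at
   level l bounds the mass of {|Kf| > 2l} by a multiple of the mass of {Mf > l}
   plus l^-2 times the integral of |f|^2 over {Mf <= l}, where M is the maximal
   function over sectors; summing over l = 2^j l_0 reduces the L^p bound to
   Doob's maximal inequality.  The case p > 2 follows from the case p < 2 for
   the adjoint of the truncated kernel.  No constant depends on the finite set,
   and the bounds pass to the limit. *)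

Set Implicit Arguments.
Unset Strict Implicit.
Unset Printing Implicit Defensive.

Import Order.TTheory GRing.Theory Num.Theory.

(** The levels start at the mean l_0 of |f| over the whole finite set. Since Mf >= l_0 everywhere,
    all values up to level l_0 are paid for by Mf itself; for l >= l_0 the root is never selected,
    so each selected sector has a parent sector, whose mean is at most l. Two series must converge
    when the levels are summed: l^p over levels below Mf needs p > 0, and l^(p-2) over levels above
    Mf needs p < 2; the maximal inequality needs p > 1. Bounding |f|^2 by a multiple of l|f| on {Mf
    <= l} would make the second series diverge. Several estimates absorb half of their left side,
    which must be finite: truncation guarantees it. Each truncated sector still contains its vertex,
    so the mass comparisons survive, and closure under predecessors keeps the parents. An atomic
    series converges only in L^1, where no bound for K is known beforehand. Boundedness of the rows
    makes g -> Kg(z) continuous on L^1 for each z, which suffices to pass to the limit in finite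
    sums over z. *)

Section RealPowers.
Local Open Scope ring_scope.
Variable R : realType.
Implicit Types (a b c t l p s e : R) (N : nat).

Lemma powR_mono p a b : 0 <= p -> 0 <= a -> a <= b -> a `^ p <= b `^ p.
Proof.
move=> p0 a0 ab; apply: ge0_ler_powR; rewrite ?nnegrE//.
exact: le_trans ab.
Qed.

Lemma powR_le0r s a b : s <= 0 -> 0 < a -> a <= b -> b `^ s <= a `^ s.
Proof.
move=> s0 a0 ab; have b0 : 0 < b := lt_le_trans a0 ab.
rewrite -[s]opprK !(powRN _ (- s)) lef_pV2 ?posrE ?powR_gt0//.
by rewrite powR_mono ?oppr_ge0 ?(ltW a0).
Qed.

Lemma powR2_gt1 p : 0 < p -> (1 : R) < 2 `^ p.
Proof.
move=> p0; have : (1 : R) `^ p < 2 `^ p.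
  by apply: gt0_ltr_powR; rewrite // ?nnegrE ?ltr1n.
by rewrite powR1.
Qed.

(** The sum of 2^(- p j) over j >= 0: it bounds the ratio of a dyadic sum of p-th powers to its
    largest term. *)
Definition geom_const p : R := (1 - 2 `^ (- p))^-1.

Lemma geom_const_gt0 p : 0 < p -> 0 < geom_const p.
Proof.
move=> p0; rewrite invr_gt0 subr_gt0 powRN invf_lt1 ?powR_gt0//.
exact: powR2_gt1.
Qed.

Lemma geom_constE p : 0 < p -> 1 + geom_const p * 2 `^ (- p) = geom_const p.
Proof.
move=> p0; have := geom_const_gt0 p0; rewrite /geom_const invr_gt0 => h.
by field; rewrite gt_eqF.
Qed.

(** The terms grow geometrically, so the sum is at most [geom_const p] times its last nonzero term,
    which is below t^p. *)
Lemma geometric_below p l N t : 0 < p -> 0 < l -> 0 <= t ->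
  \sum_(j < N) (if l * 2 ^+ j < t then (l * 2 ^+ j) `^ p else 0)
    <= geom_const p * t `^ p.
Proof.
move=> p0 l0 t0; have gp := geom_const_gt0 p0.
have l2 j : 0 <= l * 2 ^+ j by rewrite mulr_ge0 ?exprn_ge0 ?(ltW l0).
have full n : \sum_(j < n.+1) (l * 2 ^+ j) `^ p <= geom_const p * (l * 2 ^+ n) `^ p.
  elim: n => [|n IH].
    rewrite big_ord1 -{1}[_ `^ p]mul1r ler_wpM2r ?powR_ge0//.
    by rewrite -(geom_constE p0) lerDl mulr_ge0 ?powR_ge0 ?(ltW gp).
  rewrite big_ord_recr/= exprSr mulrA powRM ?l2//.
  apply: (le_trans (lerD IH (lexx _))).
  rewrite -{2}(geom_constE p0) powRN.
  have h : (2 : R) `^ p != 0 by rewrite gt_eqF ?powR_gt0.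
  by rewrite le_eqVlt; apply/orP; left; apply/eqP; field.
elim: N => [|N IH]; first by rewrite big_ord0 mulr_ge0 ?powR_ge0 ?(ltW gp).
case: (ltP (l * 2 ^+ N) t) => h; last first.
  by rewrite big_ord_recr/= ltNge h addr0.
apply: le_trans (_ : _ <= geom_const p * (l * 2 ^+ N) `^ p) _; last first.
  by rewrite ler_pM2l// powR_mono ?(ltW p0) ?(ltW h).
apply: le_trans (full N); apply: ler_sum => j _.
by case: ifP => // _; apply: powR_ge0.
Qed.

(** The largest term is now the one at the first level not below [t]. Levels are removed from the
    bottom, so the induction lets [l] double. *)
Lemma geometric_above p l N t : 0 < p -> 0 < l -> 0 < t ->
  \sum_(j < N) (if t <= l * 2 ^+ j then (l * 2 ^+ j) `^ (- p) else 0)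
    <= geom_const p * t `^ (- p).
Proof.
move=> p0 l0 t0; have gp := geom_const_gt0 p0.
have full n : forall l, 0 < l ->
    \sum_(j < n) (l * 2 ^+ j) `^ (- p) <= geom_const p * l `^ (- p).
  elim: n => [|n IH] {l0}l l0.
    by rewrite big_ord0 mulr_ge0 ?powR_ge0 ?(ltW gp).
  rewrite big_ord_recl expr0 mulr1.
  under eq_bigr do rewrite lift0 exprS mulrA.
  apply: le_trans (lerD (lexx _) (IH _ _)) _; first lra.
  rewrite powRM ?(ltW l0)// -{2}(geom_constE p0).
  by rewrite le_eqVlt; apply/orP; left; apply/eqP; ring.
elim: N l l0 => [|N IH] l l0.
  by rewrite big_ord0 mulr_ge0 ?powR_ge0 ?(ltW gp).
case: (leP t l) => h.
  apply: le_trans (_ : _ <= geom_const p * l `^ (- p)) _; last first.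
    by rewrite ler_pM2l// powR_le0r ?oppr_le0 ?(ltW p0).
  apply: le_trans (full N.+1 _ l0); apply: ler_sum => j _.
  by case: ifP => // _; apply: powR_ge0.
rewrite big_ord_recl expr0 mulr1 (leNgt t l) h.
under eq_bigr do rewrite lift0 exprS mulrA.
rewrite /= add0r.
by apply: IH; lra.
Qed.

(** If [t] exceeds [l], it lies between l 2^j (excluded) and l 2^(j+1) for some [j], and that term
    alone dominates t^p. Charging a layer at its upper end later costs a factor 2^p. *)
Lemma layer_cake p l N t : 0 <= p -> 0 <= l -> 0 <= t <= l * 2 ^+ N ->
  t `^ p <= l `^ p +
    \sum_(j < N) (if l * 2 ^+ j < t then (l * 2 ^+ j.+1) `^ p else 0).
Proof.
move=> p0 l0 /andP[t0]; have l2 j : 0 <= l * 2 ^+ j.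
  by rewrite mulr_ge0 ?exprn_ge0.
elim: N => [|N IH] tN.
  by rewrite big_ord0 addr0 powR_mono//; rewrite expr0 mulr1 in tN.
rewrite big_ord_recr/=; case: ifPn => h; last first.
  by rewrite addr0 IH// leNgt.
rewrite addrA ler_wpDl//; last exact: powR_mono.
rewrite addr_ge0 ?powR_ge0// sumr_ge0// => j _.
by case: ifP => // _; apply: powR_ge0.
Qed.

Lemma exists_pow2 l t : 0 < l -> exists N, t <= l * 2 ^+ N.
Proof.
move=> l0; exists (Num.bound (t / l)); rewrite mulrC -ler_pdivrMr//.
exact/ltW/upper_nthrootP.
Qed.

(* Either [a <= e b^(p-1)], and the first term dominates, or [b] is dominated
   by a power of [a / e]; this replaces Hoelder's inequality throughout. *)
Lemma peter_paul p e a b : 1 < p -> 0 < e -> 0 <= a -> 0 <= b ->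
  a * b `^ (p - 1) <= e * b `^ p + e `^ (1 - p) * a `^ p.
Proof.
move=> p1 e0 a0 b0; have p0 : 0 < p by lra.
case: (leP a (e * b)) => h.
  rewrite ler_wpDr ?mulr_ge0 ?powR_ge0//.
  rewrite -[leRHS]mulr1 -(mulr_powRB1 b0 p0) mulr1 mulrA.
  by rewrite ler_wpM2r ?powR_ge0.
rewrite ler_wpDl ?mulr_ge0 ?powR_ge0 ?(ltW e0)//.
have ba : b <= a / e by rewrite ler_pdivlMr// mulrC ltW.
rewrite -(mulr_powRB1 a0 p0) mulrCA ler_wpM2l//.
have -> : 1 - p = - 1 * (p - 1) by ring.
rewrite powRrM powR_inv1 ?(ltW e0)// mulrC -powRM ?invr_ge0 ?(ltW e0)//.
by apply: powR_mono => //; lra.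
Qed.

End RealPowers.

(** * The complex modulus with real values *)

Section ComplexModulus.
Local Open Scope complex_scope.
Local Open Scope ring_scope.
Variable R : realType.
Implicit Types (x y z : R[i]) (r : R).

Lemma cmod_normr x : (cmod x)%:C = `|x|. Proof. by []. Qed.

Lemma cmod_ge0 x : 0 <= cmod x.
Proof. by case: x => a b; apply: sqrtr_ge0. Qed.

Lemma cmodD x y : cmod (x + y) <= cmod x + cmod y.
Proof. by rewrite -lecR rmorphD /= !cmod_normr ler_normD. Qed.

Lemma cmodN x : cmod (- x) = cmod x.
Proof. by apply: complexI; rewrite !cmod_normr normrN. Qed.

Lemma cmodB x y : cmod (x - y) <= cmod x + cmod y.
Proof. by rewrite (le_trans (cmodD _ _))// cmodN. Qed.

Lemma cmodM x y : cmod (x * y) = cmod x * cmod y.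
Proof. exact: ComplexField.Normc.normcM. Qed.

Lemma cmod0 : cmod (0 : R[i]) = 0.
Proof. exact: ComplexField.Normc.normc0. Qed.

Lemma cmodR r : cmod r%:C = `|r|.
Proof. by rewrite /= expr0n/= addr0 sqrtr_sqr. Qed.

Lemma cmodR_ge0 r : 0 <= r -> cmod r%:C = r.
Proof. by move=> r0; rewrite cmodR ger0_norm. Qed.

Lemma cmodJ x : cmod x^* = cmod x.
Proof. by rewrite -[x^*]/(conjc x); case: x => a b /=; rewrite sqrrN. Qed.

Lemma conjR r : (r%:C)^* = r%:C.
Proof. by rewrite -[LHS]/(conjc _) conjc_real. Qed.

Lemma conjM x y : (x * y)^* = x^* * y^*.
Proof. exact: rmorphM. Qed.

Lemma conj_sum I (s : seq I) (P : pred I) (F : I -> R[i]) :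
  (\sum_(i <- s | P i) F i)^* = \sum_(i <- s | P i) (F i)^*.
Proof. exact: rmorph_sum. Qed.

Lemma cmod_eq0 x : (cmod x == 0) = (x == 0).
Proof.
apply/eqP/eqP => [|->]; last exact: cmod0.
exact: ComplexField.Normc.eq0_normc.
Qed.

Lemma mulJc x : x^* * x = (cmod x ^+ 2)%:C.
Proof.
rewrite -[x^*]/(conjc x).
case: x => a b; rewrite /= sqr_sqrtr ?addr_ge0 ?sqr_ge0//.
by simpc; congr (_ +i* _); ring.
Qed.

Lemma Re_le_cmod x : `|complex.Re x| <= cmod x.
Proof.
case: x => a b /=; rewrite -(sqrtr_sqr a); apply: ler_wsqrtr.
by rewrite lerDl sqr_ge0.
Qed.

Lemma Im_le_cmod x : `|complex.Im x| <= cmod x.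
Proof.
case: x => a b /=; rewrite -(sqrtr_sqr b); apply: ler_wsqrtr.
by rewrite lerDr sqr_ge0.
Qed.

Lemma cmod_sum I (s : seq I) (P : pred I) (F : I -> R[i]) :
  cmod (\sum_(i <- s | P i) F i) <= \sum_(i <- s | P i) cmod (F i).
Proof.
elim/big_ind2 : _ => [|a b c d ab cd|//]; first by rewrite cmod0.
exact: le_trans (cmodD _ _) (lerD ab cd).
Qed.

End ComplexModulus.

(** * Calderon-Zygmund decomposition on a finite tree *)

Section StrongTypeConstants.
Local Open Scope ring_scope.
Variable R : realType.
Implicit Types p D A H : R.

(** The 1 pays for the values up to the root mean, the other term for the dyadic layers above it;
    the exponent p - 1 is left after the weak-type bound has used one factor of the level. *)
Definition doob_layers p : R := 1 + 2 `^ p * geom_const (p - 1).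

(** With c = [doob_layers p] and e = 1 / (2 c), the bound S <= c (e S + e^(1-p) Z) absorbs S / 2 and
    leaves S <= 2 c e^(1-p) Z. *)
Definition doob_const p : R :=
  2 * doob_layers p * (2 * doob_layers p)^-1 `^ (1 - p).

(** The summands come from the values up to twice the root mean, from the masses of {Mf > l}, and
    from the L^2 part on {Mf <= l}. In 4^p, one factor 2 is the level 2 l of the weak-type bound,
    the other the upper end of a layer. *)
Definition strong_const p D A H : R :=
  (2 `^ p + 4 `^ p * (1 + A * D ^+ 2 + 2 * H * D) * geom_const p +
   4 `^ p * A * geom_const (2 - p) * D ^+ 2) * doob_const p.

Lemma doob_layers_gt0 p : 1 < p -> 0 < doob_layers p.
Proof.
move=> p1; rewrite ltr_pwDl// mulr_ge0 ?powR_ge0// ltW// geom_const_gt0//; lra.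
Qed.

End StrongTypeConstants.

Section CalderonZygmund.
Local Open Scope complex_scope.
Local Open Scope ring_scope.
Variables (R : realType) (V : finType) (w : V -> R) (T : rel V) (o : V).
Variables (dep : V -> nat) (D : R).
Implicit Types (F : V -> R) (f : V -> R[i]) (K : V -> V -> R[i]) (l : R).

(** [T v x] stands for membership of [x] in the sector of [v], so this is the mass of a truncated
    sector. *)
Definition fmass v := \sum_(x | T v x) w x.

Definition favg F v := (\sum_(x | T v x) F x * w x) / fmass v.

Definition fmax F x := \big[Num.max/0]_(v | T v x) favg F v.

Definition fker K f z : R[i] := \sum_x K z x * f x * (w x)%:C.

Hypothesis w_gt0 : forall x, 0 < w x.
Hypothesis T_refl : forall v, T v v.
Hypothesis T_root : forall x, T o x.
Hypothesis T_trans : forall u v x, T u v -> T v x -> T u x.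
Hypothesis T_nested : forall u v x, T u x -> T v x -> T u v || T v u.
Hypothesis T_dep : forall u v, T u v -> u != v -> (dep u < dep v)%N.
Hypothesis fmass_vertex : forall v, fmass v <= D * w v.
Hypothesis fmass_parent : forall v, v != o ->
  exists u, [/\ u != v, T u v & fmass u <= D * fmass v].

Lemma fmass_gt0 v : 0 < fmass v.
Proof.
rewrite /fmass (bigD1 v) ?T_refl//= ltr_pwDl//.
by rewrite sumr_ge0// => x _; exact: ltW.
Qed.

Lemma D_ge0 : 0 <= D.
Proof.
have := le_trans (ltW (fmass_gt0 o)) (fmass_vertex o).
by rewrite pmulr_lge0.
Qed.

Lemma favg_ge0 F v : (forall x, 0 <= F x) -> 0 <= favg F v.
Proof.
move=> F0; rewrite divr_ge0 ?(ltW (fmass_gt0 v))// sumr_ge0// => x _.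
by rewrite mulr_ge0 ?(ltW (w_gt0 x)).
Qed.

Lemma favg_le_fmax F v x : T v x -> favg F v <= fmax F x.
Proof. by move=> vx; apply: (le_bigmax_cond _ (favg F)). Qed.

Lemma fmax_ge0 F x : 0 <= fmax F x.
Proof. exact: bigmax_ge_id. Qed.

(** A substitute for Lebesgue differentiation: [F x * w x] is one term of the sum over the sector of
    [x], whose mass is at most [D * w x]. *)
Lemma le_fmax F x : (forall y, 0 <= F y) -> F x <= D * fmax F x.
Proof.
move=> F0; apply: le_trans (_ : D * favg F x <= _); last first.
  by rewrite ler_wpM2l ?D_ge0// favg_le_fmax.
rewrite /favg mulrA ler_pdivlMr ?fmass_gt0//.
apply: le_trans (_ : F x * (D * w x) <= _).
  by rewrite ler_wpM2l.
rewrite mulrCA ler_wpM2l ?D_ge0// (bigD1 x) ?T_refl//= lerDl.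
by rewrite sumr_ge0// => y _; rewrite mulr_ge0 ?(ltW (w_gt0 y)).
Qed.

(** The Calderon-Zygmund selection: a maximal sector among those with mean above [l]. For l >= 0,
    the selected sectors partition the set where [fmax F] exceeds [l]. *)
Definition stop F l v :=
  (l < favg F v) && [forall u, (T u v && (l < favg F u)) ==> (u == v)].

Lemma stop_fmax F l v x : stop F l v -> T v x -> l < fmax F x.
Proof. by move=> /andP[lv _] vx; exact: lt_le_trans lv (favg_le_fmax F vx). Qed.

Lemma fmax_stop F l x : 0 <= l -> l < fmax F x ->
  exists2 v, stop F l v & T v x.
Proof.
move=> l0 lM; have [v0 Pv0] : exists v, T v x && (l < favg F v).
  apply/existsP; apply: contraTT lM => /existsPn nP; rewrite -leNgt.
  apply/bigmax_leP; split=> // v vx.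
  by have := nP v; rewrite vx/= -leNgt.
(* Among the sectors through [x] with mean above [l], the vertex of least depth has the largest
   one. *)
case: (@arg_minnP _ v0 (fun v => T v x && (l < favg F v)) dep Pv0)
  => v /andP[vx lv] vmin.
exists v => //; rewrite /stop lv/=; apply/forallP => u; apply/implyP.
move=> /andP[uv lu]; apply: contraT => neq.
have := vmin u; rewrite lu (T_trans uv vx) => /(_ isT).
by rewrite leqNgt T_dep.
Qed.

Lemma stop_uniq F l u v x : stop F l u -> stop F l v ->
  T u x -> T v x -> u = v.
Proof.
move=> /andP[lu /forallP mu] /andP[lv /forallP mv] ux vx.
have /orP[uv|vu] := T_nested ux vx.
  by have := mv u; rewrite uv lu => /eqP.
by have := mu v; rewrite vu lv => /eqP.
Qed.

(** A sum over the stopping vertices above [x] acts as a selector, since disjointness leaves one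
    term. *)
Lemma sum_stop1 (M : nmodType) F l v x (h : V -> M) : stop F l v -> T v x ->
  \sum_(u | stop F l u && T u x) h u = h v.
Proof.
move=> sv vx; rewrite (big_pred1 v)// => u /=.
apply/andP/eqP => [[su ux]|->//]; exact: stop_uniq su sv ux vx.
Qed.

Lemma sum_stop (M : nmodType) F l (h : V -> M) : 0 <= l ->
  \sum_(x | l < fmax F x) h x = \sum_(v | stop F l v) \sum_(x | T v x) h x.
Proof.
move=> l0; rewrite (exchange_big_dep (fun x => l < fmax F x))/=; last first.
  by move=> v x sv vx; exact: stop_fmax sv vx.
apply: eq_bigr => x lM; have [v sv vx] := fmax_stop l0 lM.
by rewrite (sum_stop1 (fun=> h x) sv vx).
Qed.

(** The root mean is at most [l], so [v] is not the root; by maximality the mean over the larger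
    sector of [fmass_parent] is at most [l], and comparing the two masses costs [D]. *)
Lemma stop_sum F l v : (forall x, 0 <= F x) -> favg F o <= l -> stop F l v ->
  v != o /\ \sum_(x | T v x) F x * w x <= l * D * fmass v.
Proof.
move=> F0 lo /andP[lv /forallP mv].
have vo : v != o by apply: contraTneq lv => ->; rewrite -leNgt.
split => //; have [u [uv Tuv uD]] := fmass_parent vo.
have lu : favg F u <= l.
  by have := mv u; rewrite Tuv (negbTE uv)/= implybF -leNgt.
have l0 : 0 <= l := le_trans (favg_ge0 o F0) lo.
apply: le_trans (_ : l * fmass u <= _); last by rewrite -mulrA ler_wpM2l.
apply: le_trans (_ : \sum_(x | T u x) F x * w x <= _); last first.
  by move: lu; rewrite /favg ler_pdivrMr ?fmass_gt0.
rewrite [leRHS](bigID (T v))/=.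
rewrite [X in _ <= X + _](eq_bigl (T v)); last first.
  by move=> x; case: (boolP (T v x)) => [/(T_trans Tuv) ->|]; rewrite ?andbF.
by rewrite lerDl sumr_ge0// => x _; rewrite mulr_ge0 ?(ltW (w_gt0 x)).
Qed.

(** Summed over the disjoint selected sectors. Keeping only the part of [F] on the level set is what
    makes the sum over levels in Doob's inequality converge. *)
Lemma maximal_weak F l : 0 <= l ->
  l * \sum_(x | l < fmax F x) w x <= \sum_(x | l < fmax F x) F x * w x.
Proof.
move=> l0; rewrite !sum_stop// mulr_sumr; apply: ler_sum => v /andP[lv _].
by move: lv => /ltW; rewrite /favg ler_pdivlMr ?fmass_gt0.
Qed.

Lemma favg_root_eq0 F : (forall x, 0 <= F x) -> favg F o = 0 -> F =1 fun=> 0.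
Proof.
move=> F0 /eqP; rewrite mulf_eq0 invr_eq0 (gt_eqF (fmass_gt0 o)) orbF.
rewrite psumr_eq0 => [/allP Fw x|x _]; last by rewrite mulr_ge0 ?(ltW (w_gt0 x)).
have := Fw x (mem_index_enum x); rewrite T_root/= mulf_eq0.
by rewrite (gt_eqF (w_gt0 x)) orbF => /eqP.
Qed.

(** Layers and the weak inequality bound the sum of (MF)^p by a multiple of that of F (MF)^(p-1);
    [peter_paul] then lets half of the former be absorbed. *)
Lemma doob (p : R) F : 1 < p -> (forall x, 0 <= F x) ->
  \sum_x fmax F x `^ p * w x <= doob_const p * \sum_x F x `^ p * w x.
Proof.
move=> p1 F0; have c0 := doob_layers_gt0 p1; have p0 : 0 < p by lra.
have Fp0 : 0 <= \sum_x F x `^ p * w x.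
  by rewrite sumr_ge0// => x _; rewrite mulr_ge0 ?powR_ge0 ?(ltW (w_gt0 x)).
(* The dyadic levels start at the root mean, which must be positive; if it is zero, so is [F]. *)
have [l0|l0] := eqVneq (favg F o) 0.
  have F00 := favg_root_eq0 F0 l0.
  rewrite big1 => [|x _]; last first.
    suff -> : fmax F x = 0 by rewrite powR0 ?mul0r// gt_eqF.
    apply/le_anti; rewrite fmax_ge0 andbT; apply/bigmax_leP; split=> // v _.
    by rewrite /favg big1 ?mul0r// => y _; rewrite F00 mul0r.
  by rewrite !mulr_ge0 ?powR_ge0 ?(ltW c0).
set l := favg F o in l0.
have {l0} l0 : 0 < l by rewrite lt_neqAle eq_sym l0 favg_ge0.
have [N leN] := exists_pow2 (\sum_x fmax F x) l0.
have MN x : fmax F x <= l * 2 ^+ N.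
  apply: le_trans leN; rewrite (bigD1 x)//= lerDl sumr_ge0// => y _.
  exact: fmax_ge0.
have lM x : l <= fmax F x by exact: favg_le_fmax.
have l2 j : 0 <= l * 2 ^+ j by rewrite mulr_ge0 ?exprn_ge0 ?(ltW l0).
have key : \sum_x fmax F x `^ p * w x <=
    doob_layers p * \sum_x F x * fmax F x `^ (p - 1) * w x.
  apply: le_trans (_ : \sum_x (l `^ p + \sum_(j < N)
      (if l * 2 ^+ j < fmax F x then (l * 2 ^+ j.+1) `^ p else 0)) * w x <= _).
    apply: ler_sum => x _; rewrite ler_wpM2r ?(ltW (w_gt0 x))//.
    by apply: layer_cake; rewrite ?(ltW p0) ?(ltW l0) ?fmax_ge0 ?MN.
  under eq_bigr do rewrite mulrDl.
  rewrite big_split/= /doob_layers mulrDl mul1r lerD//.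
    rewrite -mulr_sumr -(mulr_powRB1 (ltW l0) p0) mulrAC.
    (* As [l] is the root mean, the base level contributes l^(p-1) times the total of [F], and [l]
       is at most the maximal function at every point. *)
    have -> : l * \sum_x w x = \sum_x F x * w x.
      have Tsum (h : V -> R) : \sum_x h x = \sum_(x | T o x) h x.
        by apply: eq_bigl => x; rewrite T_root.
      by rewrite !Tsum mulfVK// gt_eqF ?fmass_gt0.
    rewrite mulr_suml; apply: ler_sum => x _; rewrite mulrAC.
    rewrite ler_wpM2r ?(ltW (w_gt0 x))// ler_wpM2l// powR_mono ?(ltW l0)//; lra.
  under [leLHS]eq_bigr do rewrite mulr_suml.
  rewrite exchange_big/=.
  apply: le_trans (_ : \sum_(j < N) 2 `^ p * ((l * 2 ^+ j) `^ (p - 1) *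
      \sum_(x | l * 2 ^+ j < fmax F x) F x * w x) <= _).
    apply: ler_sum => j _.
    apply: le_trans (_ : 2 `^ p * ((l * 2 ^+ j) `^ (p - 1) *
      (l * 2 ^+ j * \sum_(x | l * 2 ^+ j < fmax F x) w x)) <= _); last first.
      by rewrite !ler_wpM2l ?powR_ge0// maximal_weak.
    rewrite mulrA mulrA -[in leRHS](mulrA _ _ (l * _)) (mulrC _ (l * _)).
    rewrite mulr_powRB1 // -powRM// mulr_sumr [leRHS]big_mkcond/=.
    rewrite le_eqVlt; apply/orP; left; apply/eqP; apply: eq_bigr => x _.
    by case: ifP; rewrite ?mul0r// => _; rewrite exprS (mulrCA 2 l).
  rewrite -mulr_sumr -mulrA ler_wpM2l ?powR_ge0//.
  under [leLHS]eq_bigr do rewrite mulr_sumr big_mkcond/=.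
  rewrite exchange_big/= mulr_sumr; apply: ler_sum => x _.
  apply: le_trans (_ : F x * w x * \sum_(j < N)
     (if l * 2 ^+ j < fmax F x then (l * 2 ^+ j) `^ (p - 1) else 0) <= _).
    rewrite mulr_sumr; apply: ler_sum => j _.
    by case: ifP => _; rewrite ?mulr0// mulrC.
  have Fw : 0 <= F x * w x by rewrite mulr_ge0 ?(ltW (w_gt0 x)).
  have := ler_wpM2l Fw (@geometric_below R (p - 1) l N (fmax F x) _ l0 (fmax_ge0 F x)).
  move=> /(_ ltac:(lra)) /le_trans; apply.
  by rewrite le_eqVlt; apply/orP; left; apply/eqP; ring.
set e := (2 * doob_layers p)^-1.
have e0 : 0 < e by rewrite invr_gt0 mulr_gt0.
set S := \sum_x fmax F x `^ p * w x in key *.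
have pp : \sum_x F x * fmax F x `^ (p - 1) * w x <=
    e * S + e `^ (1 - p) * \sum_x F x `^ p * w x.
  rewrite /S !mulr_sumr -big_split/=; apply: ler_sum => x _.
  by rewrite !mulrA -mulrDl ler_wpM2r ?(ltW (w_gt0 x))// peter_paul ?fmax_ge0.
have := le_trans key (ler_wpM2l (ltW c0) pp).
rewrite mulrDr mulrA [doob_layers p * e](_ : _ = 2^-1); last first.
  by rewrite /e; field; rewrite gt_eqF.
by rewrite /doob_const -/e; set Z := \sum_x F x `^ p * w x; lra.
Qed.

Variables (K : V -> V -> R[i]) (A H : R).
Hypothesis A_ge0 : 0 <= A.
Hypothesis L2 : forall f,
  \sum_z cmod (fker K f z) ^+ 2 * w z <= A * \sum_x cmod (f x) ^+ 2 * w x.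
Hypothesis hormander : forall v x, v != o -> T v x ->
  \sum_(z | ~~ T v z) cmod (K z x - K z v) * w z <= H.

Lemma fkerD f g z : fker K (fun x => f x + g x) z = fker K f z + fker K g z.
Proof.
by rewrite /fker -big_split/=; apply: eq_bigr => x _; rewrite mulrDr mulrDl.
Qed.

Lemma fker_sum (I : finType) (P : pred I) (b : I -> V -> R[i]) z :
  fker K (fun x => \sum_(i | P i) b i x) z = \sum_(i | P i) fker K (b i) z.
Proof.
rewrite /fker exchange_big/=; apply: eq_bigr => x _.
by rewrite mulr_sumr mulr_suml.
Qed.

(** * Calderon-Zygmund decomposition at one level *)

Section GoodBad.
Variables (f : V -> R[i]) (l : R).
Let F := fun x => cmod (f x).
Hypothesis l_gt0 : 0 < l.
Hypothesis favg_root : favg F o <= l.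

Let F_ge0 x : 0 <= F x. Proof. exact: cmod_ge0. Qed.

Let mean v := (\sum_(x | T v x) f x * (w x)%:C) * ((fmass v)^-1)%:C.

(** On each selected sector [f] is replaced by its mean; the sum has a single term. [bad v] is what
    remains on the sector of [v], with mean zero there. *)
Let good x :=
  if l < fmax F x then \sum_(v | stop F l v && T v x) mean v else f x.

Let bad v x := if T v x then f x - mean v else 0.

Let good_bad x : f x = good x + \sum_(v | stop F l v) bad v x.
Proof.
rewrite /good; case: ifPn => lx.
  have [v sv vx] := fmax_stop (ltW l_gt0) lx.
  rewrite (sum_stop1 mean sv vx) -big_mkcondr/=.
  by rewrite (sum_stop1 (fun v => f x - mean v) sv vx) addrC subrK.
rewrite big1 ?addr0// => v sv; rewrite /bad ifN//.
by apply: contra lx => /(stop_fmax sv).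
Qed.

Let cmod_mean v : cmod (mean v) <= favg F v.
Proof.
rewrite /mean cmodM cmodR_ge0 ?invr_ge0 ?(ltW (fmass_gt0 v))//.
rewrite ler_wpM2r ?invr_ge0 ?(ltW (fmass_gt0 v))//.
apply: le_trans (cmod_sum _ _ _) _; apply: ler_sum => x _.
by rewrite cmodM cmodR_ge0 ?(ltW (w_gt0 x)).
Qed.

Let meanE v : mean v * (fmass v)%:C = \sum_(x | T v x) f x * (w x)%:C.
Proof.
by rewrite /mean -mulrA -rmorphM/= mulVf ?mulr1// gt_eqF ?fmass_gt0.
Qed.

Let bad_norm v : stop F l v ->
  \sum_(x | T v x) cmod (bad v x) * w x <= 2 * (l * D * fmass v).
Proof.
move=> sv; have [_ Fl] := stop_sum F_ge0 favg_root sv.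
apply: le_trans (_ : \sum_(x | T v x) (F x * w x + cmod (mean v) * w x) <= _).
  apply: ler_sum => x vx; rewrite /bad vx -mulrDl.
  by rewrite ler_wpM2r ?(ltW (w_gt0 x))// cmodB.
rewrite big_split/= mulr_natl mulr2n lerD// -mulr_sumr.
apply: le_trans Fl; rewrite -ler_pdivlMr ?fmass_gt0//; exact: cmod_mean.
Qed.

(** The mean of [bad v] vanishes, so [K z v] may be subtracted from the kernel; [v] is also the base
    point in [hormander]. *)
Let bad_cancel v z : cmod (fker K (bad v) z) <=
  \sum_(x | T v x) cmod (K z x - K z v) * (cmod (bad v x) * w x).
Proof.
have -> : fker K (bad v) z =
    \sum_(x | T v x) (K z x - K z v) * bad v x * (w x)%:C.
  have m0 : \sum_(x | T v x) bad v x * (w x)%:C = 0.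
    under eq_bigr => x vx do rewrite /bad vx mulrBl.
    by rewrite sumrB -meanE /fmass rmorph_sum/= mulr_sumr subrr.
  rewrite /fker (bigID (T v))/= [X in _ + X]big1 ?addr0; last first.
    by move=> x /negbTE vx; rewrite /bad vx mulr0 mul0r.
  under [RHS]eq_bigr do rewrite 2!mulrBl.
  rewrite sumrB [X in _ - X](_ : _ = 0) ?subr0//.
  under eq_bigr do rewrite -mulrA.
  by rewrite -mulr_sumr m0 mulr0.
apply: le_trans (cmod_sum _ _ _) _; apply: ler_sum => x vx.
by rewrite !cmodM (cmodR_ge0 (ltW (w_gt0 x))) mulrA.
Qed.

(** A point where the maximal function is at most [l] lies outside every selected sector, so
    [hormander] applies to each bad part separately. *)
Let bad_far : 0 <= H ->
  \sum_(z | ~~ (l < fmax F z))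
    (\sum_(v | stop F l v) cmod (fker K (bad v) z)) * w z
  <= 2 * H * D * l * \sum_(x | l < fmax F x) w x.
Proof.
move=> H0; under eq_bigr do rewrite mulr_suml.
rewrite exchange_big/= (sum_stop _ _ (ltW l_gt0)) mulr_sumr.
apply: ler_sum => v sv; have [vo _] := stop_sum F_ge0 favg_root sv.
apply: le_trans (_ : \sum_(z | ~~ T v z) cmod (fker K (bad v) z) * w z <= _).
  rewrite [leLHS]big_mkcond [leRHS]big_mkcond/=; apply: ler_sum => z _.
  case: ifPn => lz; case: ifPn => vz //.
    by rewrite (stop_fmax sv) in lz; rewrite // -[T v z]negbK.
  by rewrite mulr_ge0 ?cmod_ge0 ?(ltW (w_gt0 z)).
apply: le_trans (_ : \sum_(z | ~~ T v z) (\sum_(x | T v x)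
    cmod (K z x - K z v) * w z * (cmod (bad v x) * w x)) <= _).
  apply: ler_sum => z _; under eq_bigr do rewrite mulrAC.
  by rewrite -mulr_suml ler_wpM2r ?(ltW (w_gt0 z))// bad_cancel.
rewrite exchange_big/=.
apply: le_trans (_ : \sum_(x | T v x) H * (cmod (bad v x) * w x) <= _).
  apply: ler_sum => x vx; rewrite -mulr_suml ler_wpM2r ?hormander//.
  by rewrite mulr_ge0 ?cmod_ge0 ?(ltW (w_gt0 x)).
rewrite -mulr_sumr -/(fmass v).
apply: le_trans (ler_wpM2l H0 (bad_norm sv)) _.
by rewrite le_eqVlt; apply/orP; left; apply/eqP; ring.
Qed.

Let good_norm :
  \sum_x cmod (good x) ^+ 2 * w x <=
  (D * l) ^+ 2 * \sum_(x | l < fmax F x) w x +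
  \sum_(x | ~~ (l < fmax F x)) F x ^+ 2 * w x.
Proof.
rewrite (bigID (fun x => l < fmax F x))/= lerD//.
  rewrite mulr_sumr; apply: ler_sum => x lx; rewrite /good lx.
  rewrite ler_wpM2r ?(ltW (w_gt0 x))//.
  have [v sv vx] := fmax_stop (ltW l_gt0) lx.
  rewrite (sum_stop1 mean sv vx) ler_sqr ?nnegrE ?cmod_ge0//; last first.
    by rewrite mulr_ge0 ?D_ge0 ?(ltW l_gt0).
  apply: le_trans (cmod_mean v) _; rewrite /favg ler_pdivrMr ?fmass_gt0//.
  by rewrite (mulrC D) (stop_sum F_ge0 favg_root sv).2.
by apply: ler_sum => x /negbTE lx; rewrite /good lx.
Qed.

(** The set where [fmax F] exceeds [l] is counted in full. Off it, the good or the bad part exceeds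
    [l], and Chebyshev's inequality is used with exponent 2 for the good part and 1 for the bad one.
    The terms [A * D ^+ 2] and [2 * H * D] come from the good part on the selected sectors and from
    the bad part. *)
Lemma weak_type : 0 <= H ->
  \sum_(z | 2 * l < cmod (fker K f z)) w z <=
  (1 + A * D ^+ 2 + 2 * H * D) * \sum_(x | l < fmax F x) w x +
  A * (l ^- 2 * \sum_(x | fmax F x <= l) F x ^+ 2 * w x).
Proof.
move=> H0; set S := \sum_(x | l < fmax F x) w x.
pose B z := \sum_(v | stop F l v) cmod (fker K (bad v) z).
have B0 z : 0 <= B z by rewrite sumr_ge0// => v _; exact: cmod_ge0.
have fle z : cmod (fker K f z) <= cmod (fker K good z) + B z.
  have -> : fker K f z = fker K (fun x =>
      good x + \sum_(v | stop F l v) bad v x) z.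
    by apply: eq_bigr => x _; rewrite -good_bad.
  rewrite fkerD fker_sum; apply: le_trans (cmodD _ _) _.
  by rewrite lerD2l cmod_sum.
apply: le_trans (_ : S + l ^- 2 * \sum_z cmod (fker K good z) ^+ 2 * w z
   + l^-1 * \sum_(z | ~~ (l < fmax F z)) B z * w z <= _).
  rewrite /S [X in X + _ + _]big_mkcond/= [X in _ + _ * X]big_mkcond/=.
  rewrite [leLHS]big_mkcond/= !mulr_sumr -!big_split/=.
  apply: ler_sum => z _; have wz := ltW (w_gt0 z).
  have g0 : 0 <= l ^- 2 * (cmod (fker K good z) ^+ 2 * w z).
    by rewrite !mulr_ge0 ?invr_ge0 ?exprn_ge0 ?cmod_ge0 ?(ltW l_gt0).
  have b0 : 0 <= l^-1 * (B z * w z).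
    by rewrite !mulr_ge0 ?invr_ge0 ?(ltW l_gt0).
  case: ifPn => lz; case: ifPn => Mz /=; rewrite ?mulr0 ?addr0 ?add0r.
  - by rewrite lerDl.
  (* Here [z] is outside the level set: if the bad part is at most [l], the good part must exceed
     [l]. *)
  - case: (leP (B z) l) => Bl.
      rewrite ler_wpDr// -mulrCA mulrA ler_peMl//.
      rewrite -exprVn -exprMn -[leLHS](expr1n _ 2).
      rewrite ler_sqr ?nnegrE ?mulr_ge0 ?invr_ge0 ?cmod_ge0 ?(ltW l_gt0)//.
      rewrite ler_pdivlMr// mul1r.
      by have := fle z; move: lz; lra.
    rewrite ler_wpDl// mulrA ler_peMl// mulrC ler_pdivlMr// mul1r.
    exact: ltW.
  - by rewrite addr_ge0.
  - by rewrite addr_ge0.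
have l2 : 0 <= l ^- 2 by rewrite invr_ge0 exprn_ge0 ?(ltW l_gt0).
apply: le_trans (lerD (lerD (lexx S) (ler_wpM2l l2 (le_trans (L2 good)
  (ler_wpM2l A_ge0 good_norm)))) (ler_wpM2l _ (bad_far H0))) _.
  by rewrite invr_ge0 ltW.
rewrite -/S; under [X in _ <= _ + _ * (_ * X)]eq_bigl do rewrite leNgt.
by rewrite le_eqVlt; apply/orP; left; apply/eqP; field; rewrite gt_eqF.
Qed.

End GoodBad.

Lemma strong_type (p : R) f : 1 < p -> p < 2 -> 0 <= H ->
  \sum_z cmod (fker K f z) `^ p * w z <=
  strong_const p D A H * \sum_x cmod (f x) `^ p * w x.
Proof.
move=> p1 p2 H0; have p0 : 0 < p by lra.
pose F x := cmod (f x); have F0 x : 0 <= F x by exact: cmod_ge0.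
rewrite /strong_const -mulrA.
set c1 := 1 + _ + _; have c10 : 0 <= c1.
  by rewrite !addr_ge0// !mulr_ge0 ?sqr_ge0 ?D_ge0.
have gp : 0 < geom_const p by exact: geom_const_gt0.
have g2 : 0 < geom_const (2 - p) by apply: geom_const_gt0; lra.
set c := _ + _ + _; have c0 : 0 <= c.
  apply: addr_ge0; [apply: addr_ge0|]; first exact: powR_ge0.
    by rewrite mulr_ge0 ?(ltW gp)// mulr_ge0// powR_ge0.
  by rewrite mulr_ge0 ?sqr_ge0// mulr_ge0 ?(ltW g2)// mulr_ge0 ?powR_ge0.
suff h : \sum_z cmod (fker K f z) `^ p * w z <= c * \sum_x fmax F x `^ p * w x.
  exact: le_trans h (ler_wpM2l c0 (doob p1 F0)).
have Mp0 : 0 <= \sum_x fmax F x `^ p * w x.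
  by rewrite sumr_ge0// => x _; rewrite mulr_ge0 ?powR_ge0 ?(ltW (w_gt0 x)).
have [l0|l0] := eqVneq (favg F o) 0.
  have F00 := favg_root_eq0 F0 l0.
  rewrite big1 ?mulr_ge0// => z _.
  rewrite /fker big1 ?cmod0 ?powR0 ?mul0r ?gt_eqF// => x _.
  suff -> : f x = 0 by rewrite mulr0 mul0r.
  by apply/eqP; rewrite -cmod_eq0; apply/eqP; exact: F00.
set l := favg F o in l0.
have {l0} l0 : 0 < l by rewrite lt_neqAle eq_sym l0 favg_ge0.
(* The layers of the image start at [2 * l], so that [weak_type] is applied only at levels not below
   the root mean. *)
have l20 : 0 < 2 * l by rewrite mulr_gt0.
have [N leN] := exists_pow2 (\sum_z cmod (fker K f z)) l20.
have KN z : cmod (fker K f z) <= 2 * l * 2 ^+ N.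
  apply: le_trans leN; rewrite (bigD1 z)//= lerDl sumr_ge0// => y _.
  exact: cmod_ge0.
have lM x : l <= fmax F x by exact: favg_le_fmax.
have M0 x : 0 < fmax F x by exact: lt_le_trans (lM x).
pose L j := l * 2 ^+ j.
have L0 j : 0 < L j by rewrite mulr_gt0 ?exprn_gt0.
have lL j : l <= L j by rewrite ler_peMr ?(ltW l0)// exprn_ege1// ler1n.
apply: le_trans (_ : \sum_z ((2 * l) `^ p + \sum_(j < N)
    (if 2 * l * 2 ^+ j < cmod (fker K f z)
     then (2 * l * 2 ^+ j.+1) `^ p else 0)) * w z <= _).
  apply: ler_sum => z _; rewrite ler_wpM2r ?(ltW (w_gt0 z))//.
  by apply: layer_cake; rewrite ?(ltW p0) ?(ltW l20) ?cmod_ge0 ?KN.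
under eq_bigr do rewrite mulrDl.
rewrite big_split/= /c -(addrA (2 `^ p)) [leRHS]mulrDl; apply: lerD.
  rewrite mulr_sumr; apply: ler_sum => z _.
  rewrite mulrA ler_wpM2r ?(ltW (w_gt0 z))// -powRM ?(ltW (M0 z))//.
  by rewrite powR_mono ?(ltW l20) ?(ltW p0)// ler_wpM2l.
under eq_bigr do rewrite mulr_suml.
rewrite exchange_big/=.
apply: le_trans (_ : \sum_(j < N) 4 `^ p * (L j `^ p *
    (c1 * \sum_(x | L j < fmax F x) w x +
     A * (L j ^- 2 * \sum_(x | fmax F x <= L j) F x ^+ 2 * w x))) <= _).
  apply: ler_sum => j _.
  apply: le_trans (_ : 4 `^ p * (L j `^ p *
      \sum_(z | 2 * L j < cmod (fker K f z)) w z) <= _); last first.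
    by rewrite !ler_wpM2l ?powR_ge0//; apply: weak_type.
  rewrite mulrA -powRM ?(ltW (L0 j))// mulr_sumr [leRHS]big_mkcond/=.
  rewrite le_eqVlt; apply/orP; left; apply/eqP; apply: eq_bigr => x _.
  rewrite /L mulrA; case: ifP; rewrite ?mul0r// => _.
  by congr (_ `^ p * _); rewrite exprS; ring.
rewrite -mulr_sumr; under [X in _ * X <= _]eq_bigr do rewrite mulrDr.
rewrite big_split/= mulrDr [leRHS]mulrDl; apply: lerD.
  rewrite -!mulrA ler_wpM2l ?powR_ge0//.
  under [leLHS]eq_bigr do rewrite mulrCA.
  rewrite -mulr_sumr ler_wpM2l//.
  under [leLHS]eq_bigr do rewrite mulr_sumr big_mkcond/=.
  rewrite exchange_big/= mulr_sumr; apply: ler_sum => x _.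
  apply: le_trans (_ : w x * \sum_(j < N)
     (if l * 2 ^+ j < fmax F x then (l * 2 ^+ j) `^ p else 0) <= _).
    rewrite mulr_sumr; apply: ler_sum => j _; rewrite /L.
    by case: ifP => _; rewrite ?mulr0// mulrC.
  rewrite mulrA [leRHS]mulrC ler_wpM2l ?(ltW (w_gt0 x))//.
  exact: geometric_below (fmax_ge0 F x).
rewrite -!mulrA ler_wpM2l ?powR_ge0//.
under [leLHS]eq_bigr do rewrite mulrCA.
rewrite -mulr_sumr ler_wpM2l//.
(* The exponent is negative because p < 2, so the levels above [fmax F x] sum to a multiple of
   (Mf)^(p-2). *)
have Lp j : L j `^ p * L j ^- 2 = L j `^ (- (2 - p)).
  rewrite -(powR_invn 2 (ltW (L0 j))) -powRD; last by rewrite (gt_eqF (L0 j)) implybT.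
  by congr (_ `^ _); ring.
under [leLHS]eq_bigr do rewrite mulrA Lp mulr_sumr big_mkcond/=.
rewrite exchange_big/= !mulr_sumr; apply: ler_sum => x _.
apply: le_trans (_ : F x ^+ 2 * w x * \sum_(j < N)
   (if fmax F x <= l * 2 ^+ j then (l * 2 ^+ j) `^ (- (2 - p)) else 0) <= _).
  rewrite mulr_sumr; apply: ler_sum => j _; rewrite /L.
  by case: ifP => _; rewrite ?mulr0// mulrC.
(* [le_fmax] turns |f|^2 (Mf)^(p-2) into D^2 (Mf)^p. *)
apply: le_trans (_ : (D * fmax F x) ^+ 2 * w x *
    (geom_const (2 - p) * fmax F x `^ (- (2 - p))) <= _).
  apply: ler_pM.
  - by rewrite mulr_ge0 ?sqr_ge0 ?(ltW (w_gt0 x)).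
  - by rewrite sumr_ge0// => j _; case: ifP => // _; exact: powR_ge0.
  - rewrite ler_wpM2r ?(ltW (w_gt0 x))// ler_sqr ?nnegrE ?le_fmax//.
    by rewrite mulr_ge0 ?D_ge0 ?fmax_ge0.
  - by apply: geometric_above => //; lra.
have -> : fmax F x `^ p = fmax F x `^ (- (2 - p)) * fmax F x ^+ 2.
  rewrite -(powR_mulrn 2 (ltW (M0 x))) -powRD; last by rewrite (gt_eqF (M0 x)) implybT.
  by congr (_ `^ _); ring.
by rewrite le_eqVlt; apply/orP; left; apply/eqP; ring.
Qed.

End CalderonZygmund.

(** * Duality *)

Section FiniteDuality.
Local Open Scope complex_scope.
Local Open Scope ring_scope.
Variables (R : realType) (V : finType) (w : V -> R).
Hypothesis w_ge0 : forall x, 0 <= w x.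
Implicit Types (f g : V -> R[i]) (K : V -> V -> R[i]).

Lemma fker_adjoint K f g :
  \sum_z fker w K f z * (g z)^* * (w z)%:C =
  \sum_x f x * (fker w (adjoint_kernel K) g x)^* * (w x)%:C.
Proof.
under eq_bigr do rewrite /fker 2!mulr_suml.
rewrite exchange_big/=; apply: eq_bigr => x _.
rewrite /fker conj_sum mulr_sumr mulr_suml.
apply: eq_bigr => z _.
rewrite /adjoint_kernel !conjM conjCK conjR; ring.
Qed.

Lemma fker_pairing_le K f g :
  cmod (\sum_z fker w K f z * (g z)^* * (w z)%:C) <=
  \sum_x cmod (f x) * cmod (fker w (adjoint_kernel K) g x) * w x.
Proof.
rewrite fker_adjoint; apply: le_trans (cmod_sum _ _ _) _.
by apply: ler_sum => x _; rewrite !cmodM cmodJ cmodR_ge0.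
Qed.

(** For h the adjoint image of g, S = ||h||^2 is the pairing of Kh with g, at most ||Kh||^2 / (2 A)
    + A ||g||^2 / 2 <= S / 2 + A ||g||^2 / 2. Absorbing S / 2 preserves the constant [A]. *)
Lemma fker_adjoint_L2 K (A : R) : 0 < A ->
  (forall f, \sum_z cmod (fker w K f z) ^+ 2 * w z <=
     A * \sum_x cmod (f x) ^+ 2 * w x) ->
  forall g, \sum_z cmod (fker w (adjoint_kernel K) g z) ^+ 2 * w z <=
     A * \sum_x cmod (g x) ^+ 2 * w x.
Proof.
move=> A0 L2 g; set h := fker w (adjoint_kernel K) g.
set S := \sum_z _; set G := \sum_x _.
have hS : S <= \sum_z cmod (fker w K h z) * cmod (g z) * w z.
  have -> : S = cmod (\sum_z fker w K h z * (g z)^* * (w z)%:C).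
    rewrite fker_adjoint -/h.
    have -> : \sum_x h x * (h x)^* * (w x)%:C = S%:C.
      rewrite rmorph_sum/=; apply: eq_bigr => x _.
      by rewrite rmorphM/= -mulJc (mulrC (h x)).
    by rewrite cmodR_ge0// sumr_ge0// => x _; rewrite mulr_ge0 ?exprn_ge0 ?cmod_ge0.
  apply: le_trans (cmod_sum _ _ _) _.
  by apply: ler_sum => x _; rewrite !cmodM cmodJ cmodR_ge0.
have AG : \sum_z cmod (fker w K h z) * cmod (g z) * w z <=
    (2 * A)^-1 * \sum_z cmod (fker w K h z) ^+ 2 * w z + (A / 2) * G.
  rewrite !mulr_sumr -big_split/=; apply: ler_sum => z _.
  rewrite !mulrA -mulrDl ler_wpM2r//.
  set a := cmod _; set b := cmod _.
  have := sqr_ge0 (a - A * b); rewrite sqrrB => k.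
  rewrite -(ler_pM2l (mulr_gt0 (ltr0Sn R 1) A0)) mulrDr !mulrA.
  rewrite mulfV ?mul1r; last by rewrite gt_eqF// mulr_gt0.
  apply: le_trans (_ : a ^+ 2 + (A * b) ^+ 2 <= _); first lra.
  by rewrite le_eqVlt; apply/orP; left; apply/eqP; field.
have := le_trans hS (le_trans AG (lerD (ler_wpM2l _ (L2 h)) (lexx _))).
rewrite -/S mulrA; have -> : (2 * A)^-1 * A = 2^-1 by field; rewrite gt_eqF.
by rewrite invr_ge0 (ltW (mulr_gt0 _ A0))// => /(_ isT); lra.
Qed.

Definition dual_const (p C : R) : R := 2 * (2 * C)^-1 `^ (1 - p).

(** Test against the extremal function g = u |u|^(p-2), where u is the image of f: the pairing
    equals S, and so does the sum of |g| to the conjugate exponent. Absorption with e = 1 / (2 C)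
    gives [dual_const]. *)
Lemma fker_dual_Lp K (p C : R) : 2 < p -> 0 < C ->
  (forall g, \sum_z cmod (fker w (adjoint_kernel K) g z) `^ (p / (p - 1)) * w z
     <= C * \sum_x cmod (g x) `^ (p / (p - 1)) * w x) ->
  forall f, \sum_z cmod (fker w K f z) `^ p * w z <=
     dual_const p C * \sum_x cmod (f x) `^ p * w x.
Proof.
move=> p2 C0 dual f; set u := fker w K f.
have p0 : 0 < p by lra. have p1 : 0 < p - 1 by lra.
have p1n : p - 1 != 0 by rewrite gt_eqF.
pose g z := u z * (cmod (u z) `^ (p - 2))%:C.
set S := \sum_z _; set F := \sum_x _.
have gE z : cmod (g z) = cmod (u z) `^ (p - 1).
  rewrite /g cmodM (cmodR_ge0 (powR_ge0 _ _)).
  have -> : p - 2 = (p - 1) - 1 by ring.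
  by rewrite mulr_powRB1 ?cmod_ge0.
have gS : \sum_x cmod (g x) `^ (p / (p - 1)) * w x = S.
  apply: eq_bigr => z _; rewrite gE -powRrM.
  by congr (_ `^ _ * _); field.
have hS : S <= \sum_x cmod (f x) * cmod (fker w (adjoint_kernel K) g x) * w x.
  have -> : S = cmod (\sum_z fker w K f z * (g z)^* * (w z)%:C).
    rewrite -/u.
    have -> : \sum_x u x * (g x)^* * (w x)%:C = S%:C.
      rewrite rmorph_sum/=; apply: eq_bigr => x _.
      rewrite /g conjM conjR mulrA (mulrC (u x)) mulJc -!rmorphM/=.
      congr (_ * _)%:C.
      rewrite expr2 -mulrA; have -> : p - 2 = (p - 1) - 1 by ring.
      by rewrite !mulr_powRB1 ?cmod_ge0.
    by rewrite cmodR_ge0// sumr_ge0// => x _; rewrite mulr_ge0 ?powR_ge0.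
  exact: fker_pairing_le.
set e := (2 * C)^-1; have e0 : 0 < e by rewrite invr_gt0 mulr_gt0.
have pp : \sum_x cmod (f x) * cmod (fker w (adjoint_kernel K) g x) * w x <=
    e * \sum_x cmod (fker w (adjoint_kernel K) g x) `^ (p / (p - 1)) * w x
    + e `^ (1 - p) * F.
  rewrite !mulr_sumr -big_split/=; apply: ler_sum => x _.
  rewrite !mulrA -mulrDl ler_wpM2r//.
  set B := cmod (fker w _ _ x); have B0 : 0 <= B by exact: cmod_ge0.
  (* The choice b = B^(1/(p-1)) makes b^(p-1) equal to [B] and b^p equal to [B] to the conjugate
     exponent. *)
  have := @peter_paul R p e (cmod (f x)) (B `^ (p - 1)^-1) _ e0 (cmod_ge0 _)
    (powR_ge0 _ _).
  rewrite -!powRrM mulVf// powRr1// (mulrC _ p); apply; lra.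
have := le_trans hS (le_trans pp (lerD (ler_wpM2l (ltW e0) (dual g)) (lexx _))).
rewrite gS mulrA; have -> : e * C = 2^-1 by rewrite /e; field; rewrite gt_eqF.
by rewrite /dual_const -/e; set Z := F; lra.
Qed.

End FiniteDuality.

(** * Unordered sums *)

Section UnorderedSums.
Local Open Scope classical_set_scope.
Local Open Scope complex_scope.
Local Open Scope ring_scope.
Variables (R : realType) (X : choiceType).
Implicit Types (S : set X) (a b u : X -> R) (f g : X -> R[i]) (U V : {fset X}).

Lemma sum_fset_split (M : nmodType) (h : X -> M) U V : (U `<=` V)%fset ->
  \sum_(x <- V) h x = \sum_(x <- U) h x + \sum_(x <- V | x \notin U) h x.
Proof.
move=> /fsubsetP UV; rewrite (bigID (fun x => x \in U))/=; congr (_ + _).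
rewrite -big_filter; apply: perm_big; apply: uniq_perm => [||x].
- exact/filter_uniq/fset_uniq.
- exact: fset_uniq.
- by rewrite mem_filter; apply/andP/idP => [[]//|xU]; split=> //; exact: UV.
Qed.

Lemma ler_sum_fset a U V : (U `<=` V)%fset -> (forall x, x \in V -> 0 <= a x) ->
  \sum_(x <- U) a x <= \sum_(x <- V) a x.
Proof.
move=> UV a0; rewrite (sum_fset_split _ UV) lerDl big_seq_cond.
by rewrite sumr_ge0// => x /andP[/a0].
Qed.

Lemma esum_ge_fset S a V : [set` V] `<=` S ->
  ((\sum_(x <- V) a x)%:E <= \esum_(x in S) (a x)%:E)%E.
Proof.
move=> VS; apply: esum_ge; exists [set` V].
  by split=> //; exact: finite_fset.
by rewrite fsbig_finite ?finite_fset//= set_fsetK sumEFin.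
Qed.

Lemma esum_le_fset S a (B : R) :
  (forall V, [set` V] `<=` S -> \sum_(x <- V) a x <= B) ->
  (\esum_(x in S) (a x)%:E <= B%:E)%E.
Proof.
move=> aB; apply: ge_ereal_sup => _ [F [finF FS] <-].
rewrite fsbig_finite// sumEFin lee_fin; apply: aB.
by rewrite fset_setK.
Qed.

Lemma esum_approx S a (e : R) : (forall x, S x -> 0 <= a x) ->
  (\esum_(x in S) (a x)%:E < +oo)%E -> 0 < e ->
  exists2 U, [set` U] `<=` S & forall V, [set` V] `<=` S -> (U `<=` V)%fset ->
    `|fine (\esum_(x in S) (a x)%:E) - \sum_(x <- V) a x| < e.
Proof.
move=> a0 afin e0.
have efin : \esum_(x in S) (a x)%:E \is a fin_num.
  by rewrite ge0_fin_numE// esum_ge0// => x Sx; rewrite lee_fin a0.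
have [_ [F [finF FS] <-]] := ub_ereal_sup_adherent e0 efin.
rewrite fsbig_finite// sumEFin => lt.
have {}lt : (\esum_(x in S) (a x)%:E - e%:E <
    (\sum_(x <- fset_set F) a x)%:E)%E by [].
move: lt; rewrite -(fineK efin) -EFinB lte_fin.
set E := fine _ => lt; exists (fset_set F) => [|V VS UV]; first by rewrite fset_setK.
have le1 := esum_ge_fset a VS; rewrite -(fineK efin) lee_fin -/E in le1.
rewrite ger0_norm ?subr_ge0//.
have : \sum_(x <- fset_set F) a x <= \sum_(x <- V) a x.
  by apply: ler_sum_fset => // x xV; apply/a0/VS.
by move: lt => /=; lra.
Qed.

(** Convergence along finite subsets ordered by inclusion. It is visibly linear, unlike [csum] with
    its positive and negative parts, and can be tested on a cofinal family such as the
    predecessor-closed sets. *)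
Definition is_csum S f (s : R[i]) : Prop := forall e : R, 0 < e ->
  exists2 U, [set` U] `<=` S & forall V, [set` V] `<=` S -> (U `<=` V)%fset ->
    cmod (s - \sum_(x <- V) f x) < e.

Definition sums_bounded S f (B : R) : Prop :=
  forall V, [set` V] `<=` S -> \sum_(x <- V) cmod (f x) <= B.

Lemma sub_fsetU S U V : [set` U] `<=` S -> [set` V] `<=` S ->
  [set` (U `|` V)%fset] `<=` S.
Proof. by move=> US VS x /=; rewrite in_fsetU => /orP[/US|/VS]. Qed.

Lemma rsum_approx S u (B e : R) :
  (forall V, [set` V] `<=` S -> \sum_(x <- V) `|u x| <= B) -> 0 < e ->
  exists2 U, [set` U] `<=` S & forall V, [set` V] `<=` S -> (U `<=` V)%fset ->
    `|rsum S u - \sum_(x <- V) u x| < e.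
Proof.
move=> uB e0; have e2 : 0 < e / 2 by rewrite divr_gt0.
have fin v : (forall x, `|v x| <= `|u x|) ->
    (\esum_(x in S) (v x)%:E < +oo)%E.
  move=> vu; apply: le_lt_trans (ltry B); apply: esum_le_fset => V VS.
  apply: le_trans (uB V VS); apply: ler_sum => x _.
  exact: le_trans (ler_norm _) (vu x).
pose up x := Num.max (u x) 0; pose un x := Num.max (- u x) 0.
have up0 x : S x -> 0 <= up x by rewrite /up le_max lexx orbT.
have un0 x : S x -> 0 <= un x by rewrite /un le_max lexx orbT.
have upu x : `|up x| <= `|u x|.
  by rewrite /up /Num.max; case: ifP => _ //; rewrite normr0.
have unu x : `|un x| <= `|u x|.
  by rewrite /un /Num.max; case: ifP => _ //; rewrite ?normr0 ?normrN.
have [U1 U1S U1P] := esum_approx up0 (fin _ upu) e2.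
have [U2 U2S U2P] := esum_approx un0 (fin _ unu) e2.
exists (U1 `|` U2)%fset => [|V VS]; first exact: sub_fsetU.
rewrite fsubUset => /andP[U1V U2V].
have -> : rsum S u = fine (\esum_(x in S) (up x)%:E) -
    fine (\esum_(x in S) (un x)%:E).
  rewrite /rsum; congr (fine _ - fine _); apply: eq_esum => x _.
    by rewrite funeposE /= /up -EFin_max.
  by rewrite funenegE /= /un -EFin_max.
have -> : \sum_(x <- V) u x = \sum_(x <- V) up x - \sum_(x <- V) un x.
  rewrite -sumrB; apply: eq_bigr => x _; rewrite /up /un /Num.max.
  by case: ifP; case: ifP; lra.
have := U1P V VS U1V; have := U2P V VS U2V.
by rewrite !ltr_norml; lra.
Qed.

Lemma is_csum_csum S f B : sums_bounded S f B -> is_csum S f (csum S f).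
Proof.
move=> fB e e0; have e2 : 0 < e / 2 by rewrite divr_gt0.
have [|U1 U1S U1P] := @rsum_approx S (fun x => complex.Re (f x)) B _ _ e2.
  move=> V VS; apply: le_trans (fB V VS); apply: ler_sum => x _.
  exact: Re_le_cmod.
have [|U2 U2S U2P] := @rsum_approx S (fun x => complex.Im (f x)) B _ _ e2.
  move=> V VS; apply: le_trans (fB V VS); apply: ler_sum => x _.
  exact: Im_le_cmod.
exists (U1 `|` U2)%fset => [|V VS]; first exact: sub_fsetU.
rewrite fsubUset => /andP[U1V U2V].
have sumE : \sum_(x <- V) f x = (\sum_(x <- V) complex.Re (f x)) +i*
    (\sum_(x <- V) complex.Im (f x)).
  elim/big_rec3 : _ => [//|x a b c _ ->].
  by case: (f x).
rewrite sumE /csum.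
set r := rsum _ _; set i := rsum _ _; set r' := \sum_(x <- V) _; set i' := bigop _ _ _.
have -> : (r +i* i) - (r' +i* i') = (r - r')%:C + (0 +i* (i - i')).
  by simpc.
apply: le_lt_trans (cmodD _ _) _; rewrite cmodR.
have -> : cmod (0 +i* (i - i')) = `|i - i'|.
  by rewrite /= expr0n add0r sqrtr_sqr.
by have := U1P V VS U1V; have := U2P V VS U2V; rewrite -/r -/i -/r' -/i'; lra.
Qed.

Lemma is_csum_unique S f s t : is_csum S f s -> is_csum S f t -> s = t.
Proof.
move=> fs ft; apply/eqP; rewrite -subr_eq0 -cmod_eq0; apply: contraT => st.
have e0 : 0 < cmod (s - t) / 2 by rewrite divr_gt0// lt_neqAle eq_sym st cmod_ge0.
have [U1 U1S U1P] := fs _ e0; have [U2 U2S U2P] := ft _ e0.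
have US := sub_fsetU U1S U2S.
have := U1P _ US (fsubsetUl _ _); have := U2P _ US (fsubsetUr _ _).
set z := \sum_(x <- _) _ => tz sz.
have : cmod (s - t) <= cmod (s - z) + cmod (t - z).
  by rewrite (le_trans _ (cmodB _ _))// opprB addrA subrK.
by move: tz sz; lra.
Qed.

Lemma csum_eq S f s B : sums_bounded S f B -> is_csum S f s -> csum S f = s.
Proof. by move=> fB; apply: is_csum_unique; exact: is_csum_csum fB. Qed.

Lemma is_csum_lin S f g s t c : is_csum S f s -> is_csum S g t ->
  is_csum S (fun x => c * f x + g x) (c * s + t).
Proof.
move=> fs gt e e0; have e2 : 0 < e / 2 by rewrite divr_gt0.
have c1 : 0 < cmod c + 1 by rewrite ltr_wpDl ?cmod_ge0.
have e3 : 0 < e / 2 / (cmod c + 1) by rewrite divr_gt0.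
have [U1 U1S U1P] := fs _ e3; have [U2 U2S U2P] := gt _ e2.
exists (U1 `|` U2)%fset => [|V VS]; first exact: sub_fsetU.
rewrite fsubUset => /andP[U1V U2V].
rewrite big_split/= -mulr_sumr.
have := U1P V VS U1V; have := U2P V VS U2V.
set b := \sum_(x <- V) _; set a := \sum_(x <- V) _ => tb sa.
have -> : c * s + t - (c * a + b) = c * (s - a) + (t - b) by ring.
apply: le_lt_trans (cmodD _ _) _; rewrite cmodM.
have : cmod c * cmod (s - a) <= e / 2.
  apply: le_trans (_ : (cmod c + 1) * cmod (s - a) <= _).
    by rewrite ler_wpM2r ?cmod_ge0// lerDl.
  by rewrite mulrC -ler_pdivlMr// ltW.
by move: tb; lra.
Qed.

Lemma is_csum_le S f s (B : R) : is_csum S f s ->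
  (forall U, [set` U] `<=` S -> exists V, [/\ [set` V] `<=` S, (U `<=` V)%fset &
     cmod (\sum_(x <- V) f x) <= B]) ->
  cmod s <= B.
Proof.
move=> fs fB; apply/ler_addgt0Pr => e e0.
have [U US UP] := fs _ e0; have [V [VS UV VB]] := fB U US.
have := UP V VS UV; set a := \sum_(x <- V) _ in VB * => lt.
by rewrite -(subrK a s) (le_trans (cmodD _ _))//; lra.
Qed.

Lemma is_csum_le_bounded S f s (B : R) : is_csum S f s -> sums_bounded S f B ->
  cmod s <= B.
Proof.
move=> fs fB; apply: (is_csum_le fs) => U US; exists U; split=> //.
exact: le_trans (cmod_sum _ _ _) (fB U US).
Qed.

Lemma is_csum_fset S f U : [set` U] `<=` S -> (forall x, x \notin U -> f x = 0) ->
  is_csum S f (\sum_(x <- U) f x).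
Proof.
move=> US f0 e e0; exists U => // V VS UV.
have h0 : \sum_(x <- V | x \notin U) f x = 0 by rewrite big1.
by rewrite (sum_fset_split _ UV) h0 addr0 subrr cmod0.
Qed.

Lemma is_csum_ext S f g s : (forall x, S x -> f x = g x) -> is_csum S f s ->
  is_csum S g s.
Proof.
move=> fg fs e e0; have [U US UP] := fs e e0; exists U => // V VS UV.
have -> : \sum_(x <- V) g x = \sum_(x <- V) f x; last exact: UP.
by rewrite big_seq [RHS]big_seq; apply: eq_bigr => x xV; rewrite fg//; exact: VS.
Qed.

Lemma sums_bounded_lin S f g B B' c : sums_bounded S f B -> sums_bounded S g B' ->
  sums_bounded S (fun x => c * f x + g x) (cmod c * B + B').
Proof.
move=> fB gB V VS.
apply: le_trans (_ : \sum_(x <- V) (cmod c * cmod (f x) + cmod (g x)) <= _).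
  by apply: ler_sum => x _; rewrite -cmodM cmodD.
by rewrite big_split/= -mulr_sumr lerD ?ler_wpM2l ?cmod_ge0 ?fB ?gB.
Qed.

(* The factor 2^p comes from (a + b)^p <= 2^p (a^p + b^p). *)
Lemma is_csum_Lp (I : choiceType) (Z : {fset I}) (S : set X) (f : I -> X -> R[i])
    (s : I -> R[i]) (w : I -> R) (p B : R) :
  0 < p -> (forall z, 0 <= w z) -> (forall z, is_csum S (f z) (s z)) ->
  (forall U, [set` U] `<=` S -> exists V, [/\ [set` V] `<=` S, (U `<=` V)%fset &
     \sum_(z <- Z) cmod (\sum_(x <- V) f z x) `^ p * w z <= B]) ->
  \sum_(z <- Z) cmod (s z) `^ p * w z <= 2 `^ p * B.
Proof.
move=> p0 w0 fs fB; set W := \sum_(z <- Z) w z.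
have W0 : 0 <= W by rewrite sumr_ge0.
apply/ler_addgt0Pr => d d0.
(* Chosen so that 2^p e^p W <= d; the added 1 keeps the denominator positive when [W] is zero. *)
pose e := (d / (2 `^ p * (W + 1))) `^ p^-1.
have q0 : 0 < d / (2 `^ p * (W + 1)).
  by rewrite divr_gt0// mulr_gt0 ?powR_gt0// ltr_wpDl.
have e0 : 0 < e by rewrite powR_gt0.
have ep : e `^ p = d / (2 `^ p * (W + 1)).
  by rewrite -powRrM mulVf ?gt_eqF// powRr1// ltW.
(* One finite set serves all [z] in [Z], as a union of one set per [z]. *)
have [U US UP] : exists2 U, [set` U] `<=` S & forall z, z \in Z -> forall V,
    [set` V] `<=` S -> (U `<=` V)%fset -> cmod (s z - \sum_(x <- V) f z x) < e.
  suff [U US UP] : exists2 U, [set` U] `<=` S &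
      forall z, z \in (Z : seq I) -> forall V,
      [set` V] `<=` S -> (U `<=` V)%fset -> cmod (s z - \sum_(x <- V) f z x) < e.
    by exists U.
  elim: (Z : seq I) => [|z r [U US UP]]; first by exists fset0.
  have [U' U'S U'P] := fs z e e0.
  exists (U `|` U')%fset => [|y yr V VS]; first exact: sub_fsetU.
  rewrite fsubUset => /andP[UV U'V]; move: yr; rewrite inE => /predU1P[->|yr].
    exact: U'P.
  exact: UP.
have [V [VS UV VB]] := fB U US.
apply: le_trans (_ : \sum_(z <- Z) 2 `^ p *
    (cmod (\sum_(x <- V) f z x) `^ p + e `^ p) * w z <= _).
  rewrite big_seq [leRHS]big_seq; apply: ler_sum => z zZ; rewrite ler_wpM2r//.
  set a := \sum_(x <- V) _.
  have lt : cmod (s z) <= cmod a + e.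
    rewrite -(subrK a (s z)); apply: le_trans (cmodD _ _) _.
    by rewrite addrC lerD2l ltW// UP.
  have ca : 0 <= cmod a by exact: cmod_ge0.
  rewrite mulrDr -!powRM ?(ltW e0)//.
  case: (leP (cmod a) e) => h.
    by rewrite ler_wpDl ?powR_ge0// powR_mono ?cmod_ge0 ?(ltW p0)//; lra.
  by rewrite ler_wpDr ?powR_ge0// powR_mono ?cmod_ge0 ?(ltW p0)//; lra.
under eq_bigr do rewrite -mulrA mulrDl.
rewrite -mulr_sumr big_split/= mulrDr lerD//.
  by rewrite ler_wpM2l ?powR_ge0.
rewrite -mulr_sumr -/W ep.
have -> : 2 `^ p * (d / (2 `^ p * (W + 1)) * W) = d * (W / (W + 1)).
  have n1 : W + 1 != 0 by rewrite gt_eqF// ltr_wpDl.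
  have n2 : (2 : R) `^ p != 0 by rewrite gt_eqF ?powR_gt0.
  by field; rewrite n1 n2.
rewrite ler_piMr ?(ltW d0)// ler_pdivrMr ?mul1r ?lerDl//.
exact: ltr_wpDl.
Qed.

End UnorderedSums.

(** * Trees *)

Section RootedTree.
Local Open Scope classical_set_scope.
Local Open Scope nat_scope.
Variables (X : choiceType) (par : X -> X) (dep : X -> nat) (o : X).

Definition rooted_tree : Prop :=
  [/\ par o = o, dep o = 0 & forall x, x != o -> dep x = (dep (par x)).+1].

(** Convertible to [sector] when [par] is [predecessor adj o]. *)
Definition descendants (v : X) : set X := [set y | exists l, iter l par y = v].

Hypothesis tree : rooted_tree.

Lemma dep_eq0 x : dep x = 0 -> x = o.
Proof.
case: tree => _ _ depS dx; apply/eqP; apply: contraT => /depS.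
by rewrite dx.
Qed.

Lemma dep_iter l y : dep (iter l par y) = dep y - l.
Proof.
case: tree => po d0 depS; elim: l => [|l IH] /=; first by rewrite subn0.
rewrite subnS -IH; have [->|/depS -> //] := eqVneq (iter l par y) o.
by rewrite po d0.
Qed.

(** Iteration stabilizes at the root, so a number of steps beyond the depth can be cut down to the
    difference of depths. *)
Lemma descendants_iter v y : descendants v y ->
  dep v <= dep y /\ iter (dep y - dep v) par y = v.
Proof.
case=> l <-; rewrite dep_iter; split; first exact: leq_subr.
case: (leqP l (dep y)) => ly; first by rewrite subKn.
have yo m : dep y <= m -> iter m par y = o.
  by move=> h; apply: dep_eq0; rewrite dep_iter; apply/eqP; rewrite subn_eq0.
rewrite !yo ?(ltnW ly)//; move: (ltnW ly).
by rewrite -subn_eq0 => /eqP ->; rewrite subn0.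
Qed.

Lemma descendants_refl v : descendants v v.
Proof. by exists 0. Qed.

Lemma descendants_root x : descendants o x.
Proof. by exists (dep x); apply: dep_eq0; rewrite dep_iter subnn. Qed.

Lemma descendants_trans u v x :
  descendants u v -> descendants v x -> descendants u x.
Proof. by case=> l <- [m <-]; exists (l + m); rewrite iterD. Qed.

Lemma descendants_nested u v x : descendants u x -> descendants v x ->
  descendants u v \/ descendants v u.
Proof.
case=> l <- [m <-]; case: (leqP l m) => h; [right; exists (m - l)|left; exists (l - m)].
  by rewrite -iterD subnK.
by rewrite -iterD subnK// ltnW.
Qed.

Lemma descendants_dep u v : descendants u v -> u != v -> dep u < dep v.
Proof.
move=> /descendants_iter[le e] uv; rewrite ltn_neqAle le andbT.
by apply: contra uv => /eqP ed; rewrite -{1}e ed subnn.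
Qed.

Lemma descendants_par v : descendants (par v) v.
Proof. by exists 1. Qed.

Lemma par_neq v : v != o -> par v != v.
Proof.
case: tree => _ _ depS /depS e; apply/eqP => pv.
by move: e; rewrite pv => /n_Sn.
Qed.

Definition par_closed (V : {fset X}) := forall x, x \in V -> par x \in V.

(** Add the root and all ancestors of points of [U]; they are finitely many, since [dep x] steps
    from [x] reach the root. *)
Lemma par_closure (U : {fset X}) : exists V : {fset X},
  [/\ (U `<=` V)%fset, o \in V & par_closed V].
Proof.
case: tree => po d0 depS.
pose anc (x : X) : {fset X} := seq_fset tt [seq iter l par x | l <- iota 0 (dep x).+1].
have ancP x y : reflect (exists l, iter l par x = y) (y \in anc x).
  rewrite seq_fsetE; apply: (iffP mapP) => [[l _ ->]|[l <-]]; first by exists l.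
  case: (leqP l (dep x)) => h; first by exists l => //; rewrite mem_iota.
  exists (dep x); first by rewrite mem_iota add0n ltnSn.
  rewrite [LHS]dep_eq0; last first.
    by rewrite dep_iter; apply/eqP; rewrite subn_eq0 ltnW.
  by rewrite [RHS]dep_eq0// dep_iter subnn.
pose V : {fset X} := seq_fset tt (o :: flatten [seq (anc x : seq X) | x <- (U : seq X)]).
have VP y : reflect (y = o \/ exists2 x, x \in U & y \in anc x) (y \in V).
  rewrite seq_fsetE inE; apply: (iffP predU1P) => -[->|h]; try by left.
    by move/flatten_mapP: h => [x xU xy]; right; exists x.
  by right; case: h => x xU xy; apply/flatten_mapP; exists x.
exists V; split.
- by apply/fsubsetP => x xU; apply/VP; right; exists x => //; apply/ancP; exists 0.
- by apply/VP; left.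
- move=> x /VP[->|[y yU /ancP[l <-]]]; apply/VP; first by left.
  by right; exists y => //; apply/ancP; exists l.+1.
Qed.

End RootedTree.

(** * Generations of a homogeneous tree *)

Section HomogeneousTree.
Local Open Scope classical_set_scope.
Variables (X : choiceType) (q : nat) (adj : rel X) (o : X).
Hypothesis q_ge2 : (2 <= q)%N.
Hypothesis treeX : homogeneous_tree q adj.

Local Notation dep := (gdist adj o).
Local Notation par := (predecessor adj o).

Lemma gdistP x : walk_length adj o x (dep x) /\
  forall m, walk_length adj o x m -> (dep x <= m)%N.
Proof.
have [s ps ls] : exists2 s, path adj o s & last o s = x.
  by case: treeX => _ _ conn _ _; exact: conn.
have ex : exists n, `[< walk_length adj o x n >].
  by exists (size s); apply/asboolP; exists s.
have [n /asboolP wn nmin] := ex_minnP ex.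
suff h : [set n | walk_length adj o x n /\
    forall m, walk_length adj o x m -> (n <= m)%N] (dep x) by exact: h.
apply: (xgetPex 0%N); exists n; split=> // m wm.
by apply: nmin; apply/asboolP.
Qed.

Lemma gdist_root : dep o = 0%N.
Proof.
apply/eqP; rewrite -leqn0; apply: (gdistP o).2.
by exists [::].
Qed.

(** The last edge of a shortest walk from [o] to [x] starts one step nearer to [o]. *)
Lemma predecessorP x : x != o -> adj x (par x) /\ dep x = (dep (par x)).+1.
Proof.
move=> xo; suff h : [set y | adj x y /\ dep x = (dep y).+1] (par x) by exact: h.
apply: xgetPex; have [[s [ps ls sz]] _] := gdistP x.
case/lastP: s ps ls sz => [_ /= xo'|s y]; first by rewrite -xo' eqxx in xo.
rewrite rcons_path last_rcons size_rcons => /andP[ps ay] yx sz.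
rewrite {}yx in ay; case: treeX => _ sym _ _ _.
exists (last o s); split; first by rewrite sym.
apply/eqP; rewrite eqn_leq; apply/andP; split.
  have [[t [pt lt szt]] _] := gdistP (last o s).
  apply: (gdistP x).2; exists (rcons t x).
  by rewrite rcons_path last_rcons size_rcons pt lt szt ay.
by rewrite -sz ltnS; apply: (gdistP _).2; exists s.
Qed.

Lemma predecessor_root : par o = o.
Proof.
rewrite /predecessor; case: xgetP => // y _ [_].
by rewrite gdist_root.
Qed.

Lemma homogeneous_rooted : rooted_tree par dep o.
Proof.
split; [exact: predecessor_root|exact: gdist_root|].
by move=> x /predecessorP[].
Qed.

(** A vertex other than the root loses its predecessor among its q + 1 neighbours; the root keeps
    them all. *)
Lemma card_children (v : X) (V : {fset X}) :
  (forall x, x \in V -> x != o /\ par x = v) ->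
  (#|` V| <= (v == o) + q)%N.
Proof.
move=> Vv; case: treeX => _ sym _ _ /(_ v) card.
set N := [set y | adj v y] in card.
have finN : finite_set N by apply/finite_setP; exists q.+1.
have VN : (V `<=` fset_set N)%fset.
  apply/fsubsetP => x /Vv[/predecessorP[+ _] xv]; rewrite xv => a.
  by rewrite in_fset_set//; apply: mem_set; rewrite /N/= sym.
have cN := card_fset_set card.
case: eqVneq => [_|vo]; first by rewrite add1n -cN; exact: fsubset_leq_card.
rewrite add0n -ltnS -cN; apply: fproper_ltn_card; rewrite fproperEneq VN andbT.
have [av dv] := predecessorP vo.
have pN : par v \in fset_set N by rewrite in_fset_set//; exact: mem_set.
apply/eqP => e; rewrite -e in pN; have [po pp] := Vv _ pN.
have [_] := predecessorP po; rewrite pp dv => /eqP.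
by rewrite -[X in X == _]addn0 -addn2 eqn_add2l.
Qed.

(** The 2 absorbs the extra child of the root, as q + 1 <= 2 q. The condition on depths keeps [o]
    out of its own later generations, since [par o = o]. *)
Lemma card_generation (v : X) k (V : {fset X}) :
  (forall x, x \in V -> iter k par x = v /\ dep x = (dep v + k)%N) ->
  (#|` V| <= 2 * q ^ k)%N.
Proof.
elim: k V => [|k IH] V Vv.
  rewrite expn0 muln1; apply: leq_trans (_ : #|` [fset v]%fset| <= _)%N; last first.
    by rewrite cardfs1.
  apply: fsubset_leq_card; apply/fsubsetP => x /Vv[/= -> _].
  by rewrite in_fset1.
have Vo x : x \in V -> x != o.
  move=> /Vv[_ dx]; apply/eqP => xo; move: dx.
  by rewrite xo gdist_root addnS.
pose V' : {fset X} := [fset par x | x in V]%fset.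
have V'v x : x \in V' -> iter k par x = v /\ dep x = (dep v + k)%N.
  move=> /imfsetP[y /= yV ->]; have [iy dy] := Vv _ yV.
  rewrite -iterSr; split=> //.
  have [_ e] := predecessorP (Vo _ yV).
  by move: dy; rewrite e addnS => -[].
have fib u : u \in V' -> (#|` [fset x in V | par x == u]%fset| <= (u == o) + q)%N.
  move=> _; apply: card_children => x; rewrite !inE/= => /andP[/Vo xo /eqP].
  by [].
have cardV : (#|` V| = \sum_(u <- V') #|` [fset x in V | par x == u]%fset|)%N.
  rewrite card_fset_sum1 (partition_big_imfset _ par)/=.
  by apply: eq_bigr => u _; rewrite card_fset_sum1 big_fset_condE.
have step c : (forall u, u \in V' -> (u == o) + q <= c)%N -> (#|` V| <= #|` V'| * c)%N.
  move=> qc; rewrite cardV card_fset_sum1 big_distrl/= big_seq [leqRHS]big_seq.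
  by apply: leq_sum => u uV; rewrite mul1n (leq_trans (fib u uV))// qc.
(* Only for the first generation can the parent be the root; afterwards parents have positive depth
   and at most q children. *)
case: k => [|k] in IH Vv V'v *.
  have V'1 : (#|` V'| <= 1)%N.
    apply: leq_trans (_ : #|` [fset v]%fset| <= _)%N; last by rewrite cardfs1.
    apply: fsubset_leq_card; apply/fsubsetP => x /V'v[/= -> _].
    by rewrite in_fset1.
  have := step q.+1 _; rewrite expn1 => /(_ _)/leq_trans -> //.
    by move=> u _; case: (u == o).
  apply: leq_trans (leq_mul V'1 (leqnn _)) _.
  by rewrite mul1n mul2n -addnn -addn1 leq_add2l ltnW.
rewrite expnSr mulnA; apply: leq_trans (step q _) _.
  move=> u /V'v[_ du]; suff -> : (u == o) = false by [].
  by apply/eqP => uo; move: du; rewrite uo gdist_root addnS.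
by rewrite leq_mul2r (IH _ V'v) orbT.
Qed.

End HomogeneousTree.

(** * Weights and masses of sectors *)

Section TreeWeight.
Local Open Scope classical_set_scope.
Local Open Scope ring_scope.
Variables (R : realType) (X : choiceType) (q : nat) (adj : rel X) (o : X).
Variable alpha : R.
Hypothesis q_ge2 : (2 <= q)%N.
Hypothesis treeX : homogeneous_tree q adj.
Hypothesis alpha_gt1 : 1 < alpha.

Local Notation dep := (gdist adj o).
Local Notation par := (predecessor adj o).
Local Notation w := (tree_weight q adj o alpha).

Let q_gt0 : 0 < q%:R :> R. Proof. by rewrite ltr0n (leq_trans _ q_ge2). Qed.

Lemma tree_weight_gt0 x : 0 < w x.
Proof. exact: powR_gt0. Qed.

Lemma tree_weight_generation v x k : dep x = (dep v + k)%N ->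
  w x = w v * (q%:R `^ (- alpha)) ^+ k.
Proof.
move=> e; rewrite /tree_weight e natrD mulrDr opprD powRD; last first.
  by rewrite (gt_eqF q_gt0) implybT.
by rewrite -(mulNr _ k%:R) (powRrM _ (- alpha) k%:R) powR_mulrn ?powR_ge0.
Qed.

Lemma tree_weight_par x : w (par x) <= q%:R `^ alpha * w x.
Proof.
have [xo|xo] := eqVneq x o.
  rewrite xo (predecessor_root o treeX) ler_peMl ?(ltW (tree_weight_gt0 o))//.
  have q1 : 1 <= q%:R :> R by rewrite ler1n (leq_trans _ q_ge2).
  have a0 : 0 <= alpha := ltW (lt_trans ltr01 alpha_gt1).
  by have := ler_powR q1 a0; rewrite powRr0.
have [_ e] := predecessorP treeX xo.
rewrite (@tree_weight_generation (par x) x 1) ?addn1// mulrCA expr1.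
rewrite -powRD; last by rewrite (gt_eqF q_gt0) implybT.
by rewrite subrr powRr0 mulr1.
Qed.

(** Generation k below [v] has at most 2 q^k vertices, each of weight q^(- alpha k) times that of
    [v]; this is the sum of the resulting series, convergent because alpha > 1. *)
Definition sector_const : R := 2 / (1 - q%:R `^ (1 - alpha)).

Let rho_lt1 : q%:R `^ (1 - alpha) < 1 :> R.
Proof.
rewrite /powR (gt_eqF q_gt0) expR_lt1 pmulr_llt0 ?subr_lt0//.
by rewrite ln_gt0// ltr1n.
Qed.

Lemma sector_const_ge0 : 0 <= sector_const.
Proof. by rewrite divr_ge0// subr_ge0 ltW. Qed.

Lemma sector_mass v (V : {fset X}) : [set` V] `<=` descendants par v ->
  \sum_(x <- V) w x <= sector_const * w v.
Proof.
move=> Vv; have tree := homogeneous_rooted o treeX.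
pose N := (\sum_(y <- V) dep y).+1.
have VN y : y \in V -> (dep y - dep v < N)%N.
  move=> yV; rewrite ltnS (leq_trans (leq_subr _ _))//.
  by rewrite (big_fsetD1 y yV)/= leq_addr.
have -> : \sum_(x <- V) w x =
    \sum_(k < N) \sum_(x <- V | (dep x - dep v)%N == k) w x.
  rewrite (exchange_big_dep xpredT)//= big_seq [RHS]big_seq.
  apply: eq_bigr => x xV.
  by rewrite (big_pred1 (Ordinal (VN x xV))).
set rho := q%:R `^ (1 - alpha).
have gen k : \sum_(x <- V | (dep x - dep v)%N == k) w x <= 2 * w v * rho ^+ k.
  rewrite big_fset_condE/=; set V' := [fset x in V | _]%fset.
  have V'v x : x \in V' -> iter k par x = v /\ dep x = (dep v + k)%N.
    rewrite !inE/= => /andP[xV /eqP <-].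
    by have [le e] := descendants_iter tree (Vv _ xV); rewrite subnKC.
  have := card_generation q_ge2 treeX V'v.
  rewrite -(ler_nat R) => cV.
  have -> : \sum_(x <- V') w x = #|` V'|%:R * (w v * (q%:R `^ (- alpha)) ^+ k).
    rewrite card_fset_sum1 natr_sum mulr_suml big_seq [RHS]big_seq.
    apply: eq_bigr => x xV'; rewrite mul1r; apply: tree_weight_generation.
    exact: (V'v _ xV').2.
  apply: le_trans (ler_wpM2r _ cV) _.
    by rewrite mulr_ge0 ?(ltW (tree_weight_gt0 v)) ?exprn_ge0 ?powR_ge0.
  have -> : rho = q%:R * q%:R `^ (- alpha).
    by rewrite /rho powRD ?(gt_eqF q_gt0) ?implybT// powRr1 ?(ltW q_gt0).
  by rewrite natrM natrX exprMn le_eqVlt; apply/orP; left; apply/eqP; ring.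
apply: le_trans (_ : \sum_(k < N) 2 * w v * rho ^+ k <= _).
  exact: ler_sum.
rewrite -mulr_sumr /sector_const -/rho [leRHS]mulrAC ler_wpM2l//.
  by rewrite mulr_ge0 ?(ltW (tree_weight_gt0 v)).
have r1 : 0 < 1 - rho by rewrite subr_gt0.
rewrite -[leRHS]mul1r ler_pdivlMr// mulrC.
have -> : (1 - rho) * \sum_(i < N) rho ^+ i = 1 - rho ^+ N.
  by have := subrX1 rho N; set Z := \sum_(i < N) _; lra.
by rewrite gerBl exprn_ge0 ?powR_ge0.
Qed.

End TreeWeight.

(** * Truncation to finite sets of vertices *)

Section Truncation.
Local Open Scope classical_set_scope.
Local Open Scope complex_scope.
Local Open Scope ring_scope.
Variables (R : realType) (X : choiceType) (par : X -> X) (dep : X -> nat) (o : X).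
Variables (w : X -> R) (D : R).
Implicit Types (K : X -> X -> R[i]) (f : X -> R[i]) (V Z : {fset X}).

Definition fsum_op K V f (z : X) : R[i] := \sum_(x <- V) K z x * f x * (w x)%:C.

Definition truncated_L2 K (A : R) : Prop := forall V f,
  \sum_(z <- V) cmod (fsum_op K V f z) ^+ 2 * w z <=
  A * \sum_(x <- V) cmod (f x) ^+ 2 * w x.

(** Only finite sums and comparisons with the vertex [v] appear, so the condition passes to every
    truncation with the same [H]. *)
Definition finite_hormander K (H : R) : Prop := forall v x Z,
  descendants par v x -> [set` Z] `<=` ~` descendants par v ->
  \sum_(z <- Z) cmod (K z x - K z v) * w z <= H.

(** Masses are compared with the point weight [w v], not with the mass of a sector: a truncated
    sector still contains [v], so both bounds survive truncation with the same [D]. *)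
Definition doubling_tree : Prop :=
  [/\ rooted_tree par dep o, forall x, 0 < w x,
   (forall v V, [set` V] `<=` descendants par v -> \sum_(x <- V) w x <= D * w v) &
   (forall v V, [set` V] `<=` descendants par (par v) ->
      \sum_(x <- V) w x <= D * w v)].

Hypothesis tree : doubling_tree.

Section FinType.
Variable V : {fset X}.
Hypothesis V_root : o \in V.
Hypothesis V_closed : par_closed par V.

Let wV (x : V) : R := w (val x).
Let TV : rel V := fun v x => `[< descendants par (val v) (val x) >].
Let oV : V := [` V_root]%fset.
Let depV (x : V) := dep (val x).

Let sumV (M : nmodType) (h : X -> M) (P : pred X) :
  \sum_(x : V | P (val x)) h (val x) = \sum_(x <- [fset x in V | P x]%fset) h x.
Proof. by rewrite -big_seq_fsetE big_fset_condE. Qed.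

Let sumVT (M : nmodType) (h : X -> M) : \sum_(x : V) h (val x) = \sum_(x <- V) h x.
Proof. by rewrite big_seq_fsetE. Qed.

Let TVP v x : reflect (descendants par (val v) (val x)) (TV v x).
Proof. exact: asboolP. Qed.

Let wV_gt0 x : 0 < wV x. Proof. by case: tree => _ w0 _ _; exact: w0. Qed.

Let sub_desc (v : X) : [set` [fset x in V | `[< descendants par v x >]]%fset]
  `<=` descendants par v.
Proof. by move=> x /=; rewrite !inE/= => /andP[_ /asboolP]. Qed.

Let fmassE v : fmass wV TV v =
  \sum_(x <- [fset x in V | `[< descendants par (val v) x >]]%fset) w x.
Proof. exact: (sumV w (fun x => `[< descendants par (val v) x >])). Qed.

Let axioms : [/\ forall v, TV v v, forall x, TV oV x,
  forall u v x, TV u v -> TV v x -> TV u x &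
  forall u v x, TV u x -> TV v x -> TV u v || TV v u].
Proof.
case: tree => rt _ _ _; split.
- by move=> v; apply/TVP; exact: descendants_refl.
- by move=> v; apply/TVP; exact: descendants_root rt _.
- by move=> u v x /TVP uv /TVP vx; apply/TVP; exact: descendants_trans uv vx.
- move=> u v x /TVP uv /TVP vx; apply/orP.
  by have [h|h] := descendants_nested uv vx; [left|right]; apply/TVP.
Qed.

Let TV_dep u v : TV u v -> u != v -> (depV u < depV v)%N.
Proof. by case: tree => rt _ _ _ /TVP uv n; exact: descendants_dep rt _ _ uv n. Qed.

Let fmassV v : fmass wV TV v <= D * wV v.
Proof. by case: tree => _ _ h _; rewrite fmassE; apply: h; exact: sub_desc. Qed.

Let fmassV_par v : v != oV ->
  exists u, [/\ u != v, TV u v & fmass wV TV u <= D * fmass wV TV v].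
Proof.
case: tree => rt w0 h1 h2 vo.
have TVr : forall u, TV u u by case: axioms.
have D0 : 0 <= D := D_ge0 oV wV_gt0 TVr fmassV.
have vo' : val v != o by [].
exists [` V_closed (valP v)]%fset; split.
- by rewrite -val_eqE/=; exact: par_neq rt _ vo'.
- by apply/TVP => /=; exact: descendants_par.
rewrite fmassE/=; apply: le_trans (h2 (val v) _ _) _; first exact: sub_desc.
rewrite ler_wpM2l// /fmass (bigD1 v)/=; last exact: TVr.
by rewrite lerDl sumr_ge0// => x _; exact: ltW.
Qed.

Let ext (f : V -> R[i]) : X -> R[i] := fun x => oapp f 0 (insub x).

Let extE (f : V -> R[i]) (x : V) : ext f (val x) = f x. Proof. by rewrite /ext valK. Qed.

Let KV K : V -> V -> R[i] := fun z x => K (val z) (val x).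

Let fker_ext K (f : V -> R[i]) z : fker wV (KV K) f z = fsum_op K V (ext f) (val z).
Proof.
rewrite /fsum_op -sumVT; apply: eq_bigr => x _.
by rewrite extE.
Qed.

Let fker_val K f z : fker wV (KV K) (f \o val) z = fsum_op K V f (val z).
Proof. exact: (sumVT (fun x => K (val z) x * f x * (w x)%:C)). Qed.

Let L2V K A : truncated_L2 K A -> forall f : V -> R[i],
  \sum_z cmod (fker wV (KV K) f z) ^+ 2 * wV z <=
  A * \sum_x cmod (f x) ^+ 2 * wV x.
Proof.
move=> L2 f.
have -> : \sum_z cmod (fker wV (KV K) f z) ^+ 2 * wV z =
    \sum_(z <- V) cmod (fsum_op K V (ext f) z) ^+ 2 * w z.
  by rewrite -sumVT; apply: eq_bigr => z _; rewrite fker_ext.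
have -> : \sum_x cmod (f x) ^+ 2 * wV x = \sum_(x <- V) cmod (ext f x) ^+ 2 * w x.
  by rewrite -sumVT; apply: eq_bigr => x _; rewrite extE.
exact: L2.
Qed.

Let hormanderV K H : finite_hormander K H -> forall v x, v != oV -> TV v x ->
  \sum_(z | ~~ TV v z) cmod (KV K z x - KV K z v) * wV z <= H.
Proof.
move=> hK v x _ /TVP vx.
rewrite (sumV (fun z => cmod (K z (val x) - K z (val v)) * w z)
  (fun z => ~~ `[< descendants par (val v) z >])).
apply: hK => //= z /=; rewrite !inE/= => /andP[_ /asboolPn].
by [].
Qed.

Lemma truncated_strong K (A H p : R) f : 1 < p -> p < 2 -> 0 <= A -> 0 <= H ->
  truncated_L2 K A -> finite_hormander K H ->
  \sum_(z <- V) cmod (fsum_op K V f z) `^ p * w z <=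
  strong_const p D A H * \sum_(x <- V) cmod (f x) `^ p * w x.
Proof.
move=> p1 p2 A0 H0 L2 hK; case: axioms => a1 a2 a3 a4.
have := strong_type wV_gt0 a1 a2 a3 a4 TV_dep fmassV fmassV_par A0 (L2V L2)
  (hormanderV hK) (f \o val) p1 p2 H0.
rewrite -!sumVT; congr (_ <= _).
by apply: eq_bigr => z _; rewrite fker_val.
Qed.

Lemma truncated_dual K (A H p C : R) f : 2 < p -> 0 < A -> 0 <= H ->
  strong_const (p / (p - 1)) D A H <= C -> 0 < C ->
  truncated_L2 K A -> finite_hormander (adjoint_kernel K) H ->
  \sum_(z <- V) cmod (fsum_op K V f z) `^ p * w z <=
  dual_const p C * \sum_(x <- V) cmod (f x) `^ p * w x.
Proof.
move=> p2 A0 H0 sC C0 L2 hK; case: axioms => a1 a2 a3 a4.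
have w0 x : 0 <= wV x by exact: ltW.
have p1 : 0 < p - 1 by lra.
have q1 : 1 < p / (p - 1) by rewrite ltr_pdivlMr//; lra.
have q2 : p / (p - 1) < 2 by rewrite ltr_pdivrMr//; lra.
have L2' := fker_adjoint_L2 w0 A0 (L2V L2).
have dual g : \sum_z cmod (fker wV (adjoint_kernel (KV K)) g z)
      `^ (p / (p - 1)) * wV z <= C * \sum_x cmod (g x) `^ (p / (p - 1)) * wV x.
  apply: le_trans (_ : strong_const (p / (p - 1)) D A H *
      \sum_x cmod (g x) `^ (p / (p - 1)) * wV x <= _); last first.
    by rewrite ler_wpM2r// sumr_ge0// => x _; rewrite mulr_ge0 ?powR_ge0.
  exact: (strong_type wV_gt0 a1 a2 a3 a4 TV_dep fmassV fmassV_par (ltW A0) L2'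
    (hormanderV hK) g q1 q2 H0).
have := fker_dual_Lp w0 p2 C0 dual (f \o val).
rewrite -!sumVT; congr (_ <= _).
by apply: eq_bigr => z _; rewrite fker_val.
Qed.

End FinType.
End Truncation.

(** * Passage to the infinite tree *)

Section LpNorms.
Local Open Scope classical_set_scope.
Local Open Scope complex_scope.
Local Open Scope ring_scope.
Variables (R : realType) (X : choiceType) (w : X -> R).
Hypothesis w_gt0 : forall x, 0 < w x.
Implicit Types (f g : X -> R[i]) (V Z : {fset X}) (p L B : R).

Lemma powR_le1D p (s t : R) : 0 <= s -> s <= p -> 0 <= t -> t `^ s <= 1 + t `^ p.
Proof.
move=> s0 sp t0; case: (leP t 1) => t1.
  have : t `^ s <= 1 `^ s by rewrite powR_mono.
  by rewrite powR1 => /le_trans; apply; rewrite lerDl powR_ge0.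
by rewrite ler_wpDl// ler_powR// ltW.
Qed.

Lemma Lpnorm_leP p f L : 0 < p -> 0 <= L ->
  (Lpnorm w p%:E f <= L%:E)%E <->
  forall V, \sum_(x <- V) cmod (f x) `^ p * w x <= L `^ p.
Proof.
move=> p0 L0; rewrite /Lpnorm.
have p1 : p^-1 * p = 1 by rewrite mulVf// gt_eqF.
have p1' : p * p^-1 = 1 by rewrite mulfV// gt_eqF.
set E := esum _ _.
have E0 : (0 <= E)%E.
  apply: esum_ge0 => x _; rewrite lee_fin mulr_ge0 ?powR_ge0//.
  exact: ltW.
split=> [h V|h].
  have : (E <= (L `^ p)%:E)%E.
    move: h; case: E E0 => [e||] e0 h //.
      move: h; rewrite poweR_EFin !lee_fin => h.
      rewrite -[e]powRr1// -p1 powRrM powR_mono ?powR_ge0//; exact: ltW.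
    by move: h; rewrite poweRyr ?invr_eq0 ?gt_eqF// leye_eq.
  move=> EL; rewrite -lee_fin; apply: le_trans EL.
  exact: (@esum_ge_fset _ _ _ (fun x => cmod (f x) `^ p * w x)).
have : (E <= (L `^ p)%:E)%E by apply: esum_le_fset => V _; exact: h.
case: E E0 => [e||] e0 //.
rewrite poweR_EFin !lee_fin => {}h.
rewrite -[L]powRr1// -p1' powRrM powR_mono// invr_ge0; exact: ltW.
Qed.

Lemma Lp_bound p f : 0 < p -> Lp w p%:E f ->
  exists L, [/\ 0 <= L, Lpnorm w p%:E f = L%:E &
    forall V, \sum_(x <- V) cmod (f x) `^ p * w x <= L `^ p].
Proof.
move=> p0 fp; have n0 : (0 <= Lpnorm w p%:E f)%E by exact: poweR_ge0.
have fin : Lpnorm w p%:E f \is a fin_num by rewrite ge0_fin_numE.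
exists (fine (Lpnorm w p%:E f)); split; [exact: fine_ge0|by rewrite fineK|].
by apply/Lpnorm_leP => //; [exact: fine_ge0|rewrite fineK].
Qed.

Lemma Lpnorm1_leP f L : 0 <= L ->
  (Lpnorm w 1%E f <= L%:E)%E <-> forall V, \sum_(x <- V) cmod (f x) * w x <= L.
Proof.
move=> L0; have h := @Lpnorm_leP 1 f L ltr01 L0; rewrite powRr1// in h.
split=> [/h k V|k]; last (apply/h => V; move: (k V)).
  by have := k V; under eq_bigr do rewrite powRr1 ?cmod_ge0//.
by under [X in _ -> X <= _]eq_bigr do rewrite powRr1 ?cmod_ge0//.
Qed.

Lemma Lpnorm_oo_leP f L : (Lpnorm w +oo%E f <= L%:E)%E <-> forall x, cmod (f x) <= L.
Proof.
rewrite /Lpnorm; split=> [h x|h].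
  by rewrite -lee_fin; apply: le_trans h; apply: ereal_sup_ubound; exists x.
by apply: ge_ereal_sup => _ [x _ <-]; rewrite lee_fin.
Qed.

End LpNorms.

Section TreeKernel.
Local Open Scope classical_set_scope.
Local Open Scope complex_scope.
Local Open Scope ring_scope.
Variables (R : realType) (X : choiceType) (par : X -> X) (dep : X -> nat) (o : X).
Variables (w : X -> R) (D : R).
Hypothesis tree : doubling_tree par dep o w D.
Variable K : X -> X -> R[i].
Implicit Types (f g : X -> R[i]) (V Z : {fset X}) (p L B A : R).

Let w_gt0 x : 0 < w x. Proof. by case: tree => _ w0 _ _; exact: w0. Qed.
Let w_ge0 x : 0 <= w x. Proof. exact: ltW. Qed.

Definition kernel_summable f : Prop := forall z,
  exists B, sums_bounded [set: X] (fun x => K z x * f x * (w x)%:C) B.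

Lemma kernel_op_is_csum f z : kernel_summable f ->
  is_csum [set: X] (fun x => K z x * f x * (w x)%:C) (kernel_op w K f z).
Proof. by move=> /(_ z)[B fB]; exact: is_csum_csum fB. Qed.

Lemma kernel_summable_lin f g c : kernel_summable f -> kernel_summable g ->
  kernel_summable (fun x => c * f x + g x).
Proof.
move=> fs gs z; have [B fB] := fs z; have [B' gB] := gs z.
exists (cmod c * B + B') => V VS.
have := sums_bounded_lin c fB gB VS; congr (_ <= _).
by apply: eq_bigr => x _; congr (cmod _); ring.
Qed.

Lemma kernel_op_lin f g c : kernel_summable f -> kernel_summable g ->
  kernel_op w K (fun x => c * f x + g x) =
  (fun x => c * kernel_op w K f x + kernel_op w K g x).
Proof.
move=> fs gs; apply/funext => z.
apply: is_csum_unique (kernel_op_is_csum z (kernel_summable_lin c fs gs)) _.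
apply: is_csum_ext (is_csum_lin c (kernel_op_is_csum z fs) (kernel_op_is_csum z gs)).
by move=> x _; ring.
Qed.

Lemma total_mass V : \sum_(x <- V) w x <= D * w o.
Proof. by case: tree => rt _ h _; apply: h => x _; exact: descendants_root rt x. Qed.

(** From t^s <= 1 + t^p and finite total mass. The bound is not homogeneous, so it serves only for
    summability. *)
Lemma Lp_sub p f L s : 0 <= s -> s <= p ->
  (forall V, \sum_(x <- V) cmod (f x) `^ p * w x <= L) ->
  forall V, \sum_(x <- V) cmod (f x) `^ s * w x <= D * w o + L.
Proof.
move=> s0 sp fL V; apply: le_trans (_ : \sum_(x <- V) (w x + cmod (f x) `^ p * w x) <= _).
  apply: ler_sum => x _; rewrite -{2}[w x]mul1r -mulrDl ler_wpM2r//.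
  by rewrite powR_le1D ?cmod_ge0.
by rewrite big_split/= lerD ?fL ?total_mass.
Qed.

Definition L2_bounded A : Prop := forall f B, 0 <= B ->
  (forall V, \sum_(x <- V) cmod (f x) ^+ 2 * w x <= B) ->
  kernel_summable f /\
  forall V, \sum_(z <- V) cmod (kernel_op w K f z) ^+ 2 * w z <= A * B.

Lemma kernel_bounded_L2_bounded : kernel_bounded_L2 w K ->
  exists2 A, 0 < A & L2_bounded A.
Proof.
(* The 1 makes [A] positive whatever [M] is, because the duality argument divides by [A]. *)
case=> Ksum [_ _ [M KM]]; exists (M ^+ 2 + 1).
  by rewrite ltr_wpDl ?sqr_ge0.
have pow2 (t : R) : 0 <= t -> t `^ 2 = t ^+ 2 by move=> t0; rewrite powR_mulrn.
move=> f B B0 fB; pose L := Num.sqrt B.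
have L2 : L `^ 2 = B by rewrite pow2 ?sqrtr_ge0// sqr_sqrtr.
have fL : (Lpnorm w 2%:E f <= L%:E)%E.
  apply/Lpnorm_leP => //; rewrite ?sqrtr_ge0// => V.
  by rewrite L2; under eq_bigr do rewrite pow2 ?cmod_ge0//.
have fL2 : Lp w 2%:E f by exact: le_lt_trans fL (ltry _).
split=> [z|V].
  have := Ksum f fL2 z; rewrite /summable => fin.
  set E := esum _ _ in fin.
  have Ef : E \is a fin_num by rewrite ge0_fin_numE// esum_ge0.
  exists (fine E) => V VS; rewrite -lee_fin fineK//.
  have -> : E = \esum_(x in [set: X]) (cmod (K z x * f x * (w x)%:C))%:E.
    apply: eq_esum => x _.
    by rewrite gee0_abs ?lee_fin ?mulr_ge0 ?cmod_ge0//
      [in RHS]cmodM (cmodR_ge0 (w_ge0 x)).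
  exact: esum_ge_fset.
have KL : (Lpnorm w 2%:E (kernel_op w K f) <= (`|M| * L)%:E)%E.
  apply: le_trans (KM f fL2) _; rewrite EFinM.
  apply: le_trans (_ : (`|M|%:E * Lpnorm w 2%:E f <= _)%E).
    by apply: lee_wpmul2r; [exact: poweR_ge0|rewrite lee_fin ler_norm].
  by apply: lee_wpmul2l; rewrite ?lee_fin.
have L0 : 0 <= L by exact: sqrtr_ge0.
have /Lpnorm_leP h := KL.
have := h w_gt0 (ltr0Sn R 1) (mulr_ge0 (normr_ge0 M) L0) V.
rewrite pow2 ?mulr_ge0// exprMn -(pow2 L)// L2 real_normK ?num_real//.
under eq_bigr do rewrite pow2 ?cmod_ge0//.
move=> /le_trans; apply; rewrite ler_wpM2r// lerDl//.
Qed.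

Lemma kernel_op_fset V f z : kernel_op w K (fun x => if x \in V then f x else 0) z
  = fsum_op w K V f z.
Proof.
have ext0 x : x \notin V ->
    K z x * (if x \in V then f x else 0) * (w x)%:C = 0.
  by move=> /negbTE ->; rewrite mulr0 mul0r.
have h : is_csum [set: X] (fun x => K z x * (if x \in V then f x else 0) * (w x)%:C)
    (fsum_op w K V f z).
  have -> : fsum_op w K V f z =
      \sum_(x <- V) K z x * (if x \in V then f x else 0) * (w x)%:C.
    by rewrite /fsum_op big_seq [RHS]big_seq; apply: eq_bigr => x ->.
  exact: is_csum_fset.
apply: (@csum_eq _ _ _ _ _ (\sum_(x <- V)
  cmod (K z x * (if x \in V then f x else 0) * (w x)%:C)) _ h).
move=> U _; apply: le_trans (_ : \sum_(x <- (U `|` V)%fset)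
    cmod (K z x * (if x \in V then f x else 0) * (w x)%:C) <= _).
  apply: (ler_sum_fset (a := fun x =>
    cmod (K z x * (if x \in V then f x else 0) * (w x)%:C))) => [|x _].
    exact: fsubsetUl.
  exact: cmod_ge0.
rewrite (sum_fset_split _ (fsubsetUr U V)) [X in _ + X <= _]big1 ?addr0//.
by move=> x xV; rewrite ext0 ?cmod0.
Qed.

(** Apply the bound to [f] cut off to [V] and drop the points outside [V]; one [A] serves all
    [V]. *)
Lemma L2_bounded_truncated A : L2_bounded A -> truncated_L2 w K A.
Proof.
move=> L2 V f; pose g x := if x \in V then f x else 0.
have gV (U : {fset X}) :
    \sum_(x <- U) cmod (g x) ^+ 2 * w x <= \sum_(x <- V) cmod (f x) ^+ 2 * w x.
  apply: le_trans (_ : \sum_(x <- (U `|` V)%fset) cmod (g x) ^+ 2 * w x <= _).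
    apply: ler_sum_fset => [|x _]; first exact: fsubsetUl.
    by rewrite mulr_ge0 ?exprn_ge0 ?cmod_ge0.
  rewrite (sum_fset_split _ (fsubsetUr U V)) [X in _ + X <= _]big1 ?addr0.
    rewrite big_seq [leRHS]big_seq; apply: ler_sum => x xV.
    by rewrite /g xV.
  by move=> x /negbTE xV; rewrite /g xV cmod0 expr0n mul0r.
have [|_ h] := L2 g _ _ gV.
  by rewrite sumr_ge0// => x _; rewrite mulr_ge0 ?exprn_ge0 ?cmod_ge0.
have := h V; congr (_ <= _); apply: eq_bigr => z _.
by rewrite kernel_op_fset.
Qed.

(** The inner sums may be taken over closed sets [V] containing [Z], where the truncated bound
    applies; [is_csum_Lp] performs the limit and contributes 2^p. *)
Lemma Lp_transfer p (C L : R) f : 0 < p -> 0 <= C -> kernel_summable f ->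
  (forall V, o \in V -> par_closed par V ->
     \sum_(z <- V) cmod (fsum_op w K V f z) `^ p * w z <=
     C * \sum_(x <- V) cmod (f x) `^ p * w x) ->
  (forall V, \sum_(x <- V) cmod (f x) `^ p * w x <= L) ->
  forall Z, \sum_(z <- Z) cmod (kernel_op w K f z) `^ p * w z <= 2 `^ p * (C * L).
Proof.
move=> p0 C0 fs CV fL Z; case: tree => rt _ _ _.
apply: (@is_csum_Lp R X X Z [set: X] (fun z x => K z x * f x * (w x)%:C)) => //.
  by move=> z; exact: kernel_op_is_csum.
move=> U _; have [V [UV oV clV]] := par_closure rt (U `|` Z)%fset.
move: UV; rewrite fsubUset => /andP[UV ZV].
exists V; split=> //; apply: le_trans (ler_wpM2l C0 (fL V)).
apply: le_trans (CV V oV clV); apply: ler_sum_fset => // x _.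
by rewrite mulr_ge0 ?powR_ge0.
Qed.

Lemma extends_bounded_Lp p (C : R) : 1 <= p -> 0 <= C ->
  (forall f, Lp w p%:E f -> kernel_summable f) ->
  (forall f V, o \in V -> par_closed par V ->
     \sum_(z <- V) cmod (fsum_op w K V f z) `^ p * w z <=
     C * \sum_(x <- V) cmod (f x) `^ p * w x) ->
  extends_bounded w K (Lp w p%:E) (Lp w p%:E) (Lpnorm w p%:E) (Lpnorm w p%:E).
Proof.
move=> p1 C0 fs CV; have p0 : 0 < p by lra.
(* Its p-th power is 2^p C, the constant of [Lp_transfer]. *)
pose M := 2 * C `^ p^-1.
have M0 : 0 <= M by rewrite mulr_ge0 ?powR_ge0.
have bound f : Lp w p%:E f ->
    (Lpnorm w p%:E (kernel_op w K f) <= M%:E * Lpnorm w p%:E f)%E.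
  move=> fp; have [L [L0 -> fL]] := Lp_bound w_gt0 p0 fp.
  rewrite -EFinM; apply/Lpnorm_leP => //; first exact: mulr_ge0.
  move=> V; rewrite !powRM ?powR_ge0// -powRrM mulVf ?gt_eqF// powRr1//.
  rewrite -mulrA; apply: Lp_transfer => //; first exact: fs.
  by move=> U; exact: CV.
exists (kernel_op w K) => //; split; last by exists M.
  move=> f fp; apply: le_lt_trans (bound f fp) _.
  by have [L [L0 -> _]] := Lp_bound w_gt0 p0 fp; rewrite -EFinM ltry.
by move=> c f g fp gp; apply: kernel_op_lin; exact: fs.
Qed.

Lemma L2_bounded_summable A p f : 2 <= p -> L2_bounded A -> Lp w p%:E f ->
  kernel_summable f.
Proof.
move=> p2 L2 fp; have p0 : 0 < p by lra.
have [L [L0 _ fL]] := Lp_bound w_gt0 p0 fp.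
have h := Lp_sub (ler0n R 2) p2 fL.
have [] // := L2 f (D * w o + L `^ p) _ _.
  rewrite addr_ge0 ?powR_ge0//; have := h fset0; rewrite big_seq_fset0.
  have := total_mass fset0; by rewrite big_seq_fset0.
by move=> V; have := h V; under eq_bigr do rewrite powR_mulrn ?cmod_ge0//.
Qed.

End TreeKernel.

(** * Endpoint estimates *)

Section Endpoints.
Local Open Scope classical_set_scope.
Local Open Scope complex_scope.
Local Open Scope ring_scope.
Variables (R : realType) (X : choiceType) (par : X -> X) (dep : X -> nat) (o : X).
Variables (w : X -> R) (D : R).
Hypothesis tree : doubling_tree par dep o w D.
Variable K : X -> X -> R[i].
Implicit Types (f g : X -> R[i]) (V Z : {fset X}) (S : set X) (p L B : R).

Let w_gt0 x : 0 < w x. Proof. by case: tree => _ w0 _ _; exact: w0. Qed.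
Let w_ge0 x : 0 <= w x. Proof. exact: ltW. Qed.

Lemma doubling_ge1 : 1 <= D.
Proof.
case: tree => _ _ /(_ o [fset o]%fset) h _.
have : \sum_(x <- [fset o]%fset) w x <= D * w o.
  by apply: h => x /=; rewrite in_fset1 => /eqP ->; exact: descendants_refl.
by rewrite big_seq_fset1 -[leLHS]mul1r ler_pM2r.
Qed.

Lemma weight_root u : w o <= D ^+ dep u * w u.
Proof.
case: tree => rt _ _ h2; have [_ d0 depS] := rt.
have D0 : 0 <= D := le_trans ler01 doubling_ge1.
move: {2}(dep u) (erefl (dep u)) => n; elim: n u => [|n IH] u du.
  by rewrite (dep_eq0 rt du) d0 expr0 mul1r.
have uo : u != o.
  by apply/eqP => uo; rewrite uo d0 in du.
have dp : dep (par u) = n by move: du; rewrite (depS _ uo) => -[].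
apply: le_trans (IH _ dp) _.
rewrite dp du exprSr -mulrA ler_wpM2l ?exprn_ge0//.
have := h2 u [fset par u]%fset; rewrite big_seq_fset1; apply => x /=.
by rewrite in_fset1 => /eqP ->; exact: descendants_refl.
Qed.

(** Test the L^2 bound on the indicator of [u] and keep the single term at [z]. *)
Lemma kernel_entry (A : R) z u : truncated_L2 w K A ->
  cmod (K z u) ^+ 2 * (w u * w z) <= A.
Proof.
move=> L2; set V := [fset z; u]%fset.
have zV : z \in V by rewrite in_fset2 eqxx.
have uV : u \in V by rewrite in_fset2 eqxx orbT.
have := L2 V (fun x => if x == u then 1 else 0).
rewrite [X in _ <= _ * X](big_fsetD1 u uV)/= eqxx cmodR_ge0 ?ler01//.
rewrite [X in _ <= _ * (_ + X)]big1_fset ?addr0; last first.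
  move=> x; rewrite in_fsetD1 => /andP[/negbTE -> _] _.
  by rewrite cmod0 expr0n mul0r.
rewrite (big_fsetD1 z zV)/= => h.
have {h} : cmod (fsum_op w K V (fun x => if x == u then 1 else 0) z) ^+ 2 * w z
    <= A * (1 ^+ 2 * w u).
  apply: le_trans h; rewrite lerDl sumr_ge0// => x _.
  by rewrite mulr_ge0 ?exprn_ge0 ?cmod_ge0.
rewrite /fsum_op (big_fsetD1 u uV)/= eqxx big1_fset ?addr0; last first.
  by move=> x; rewrite in_fsetD1 => /andP[/negbTE -> _] _; rewrite mulr0 mul0r.
rewrite mulr1 cmodM (cmodR_ge0 (w_ge0 u)) exprMn expr1n mul1r => h.
rewrite -(ler_pM2r (w_gt0 u)); apply: le_trans h.
by rewrite le_eqVlt; apply/orP; left; apply/eqP; ring.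
Qed.

(* The highest ancestor u of x whose sector avoids z is at most one generation
   below z. *)
Lemma separating_sector z x : exists2 u, (dep u <= (dep z).+1)%N &
  u = x \/ descendants par u x /\ ~ descendants par u z.
Proof.
case: tree => rt _ _ _; have [_ d0 depS] := rt.
move: {2}(dep x) (erefl (dep x)) => n; elim: n x => [|n IH] x dx.
  by exists x; [rewrite dx|left].
have xo : x != o by apply/eqP => xo; rewrite xo d0 in dx.
have dp : dep (par x) = n by move: dx; rewrite (depS _ xo) => -[].
have [pz|pz] := pselect (descendants par (par x) z).
  by exists x; [rewrite dx -dp ltnS; case: (descendants_iter rt pz)|left].
have [u du [up|[up uz]]] := IH _ dp; exists u => //; right.
  by rewrite up; split=> //; exact: descendants_par.
by split=> //; exact: descendants_trans up (descendants_par par x).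
Qed.

(** For [u] from [separating_sector], the bound on its depth bounds [w u] from below, so
    [kernel_entry] controls K(z,u). If [u] is not [x], its sector contains [x] and avoids [z], and
    the Hoermander sum has |K(z,x) - K(z,u)| [w z] as one term. *)
Lemma kernel_row_bounded (A H : R) : 0 <= A -> 0 <= H ->
  truncated_L2 w K A -> finite_hormander par w K H ->
  exists B : X -> R, forall z x, cmod (K z x) <= B z.
Proof.
move=> A0 H0 L2 hK; case: tree => rt _ _ _.
(* From t^2 <= s follows t <= 1 + s, which avoids square roots. *)
exists (fun z => 1 + A * D ^+ (dep z).+1 / (w o * w z) + H / w z) => z x.
have [u du ux] := separating_sector z x.
have Ku : cmod (K z u) <= 1 + A * D ^+ (dep z).+1 / (w o * w z).
  have k := kernel_entry z u L2; set t := cmod (K z u) in k *.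
  have : t ^+ 2 <= A * D ^+ (dep z).+1 / (w o * w z).
    rewrite ler_pdivlMr ?mulr_gt0//.
    apply: le_trans (_ : D ^+ (dep z).+1 * (t ^+ 2 * (w u * w z)) <= _).
      rewrite [leRHS]mulrCA ler_wpM2l ?sqr_ge0// mulrA ler_wpM2r//.
      apply: le_trans (weight_root u) _; rewrite ler_wpM2r//.
      by apply: ler_weXn2l du; exact: doubling_ge1.
    by rewrite mulrC ler_wpM2r// exprn_ge0// (le_trans ler01 doubling_ge1).
  have : 0 <= (t - 1) ^+ 2 by exact: sqr_ge0.
  have : 0 <= t by exact: cmod_ge0.
  rewrite sqrrB expr1n mulr1 => t0 h1 h2.
  case: (leP t 1) => t1; first by rewrite (le_trans t1)// lerDl (le_trans _ h2) ?sqr_ge0.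
  by lra.
case: ux => [<-|[dux duz]].
  by apply: le_trans Ku _; rewrite lerDl divr_ge0.
rewrite -(subrK (K z u) (K z x)) addrC; apply: le_trans (cmodD _ _) _.
rewrite lerD// ler_pdivlMr//.
have := hK u x [fset z]%fset dux _; rewrite big_seq_fset1; apply.
by move=> y /=; rewrite in_fset1 => /eqP ->.
Qed.

Section RowBounded.
Variable B : X -> R.
Hypothesis KB : forall z x, cmod (K z x) <= B z.

Lemma row_bounded_L1 f L : (forall V, \sum_(x <- V) cmod (f x) * w x <= L) ->
  forall z, sums_bounded [set: X] (fun x => K z x * f x * (w x)%:C) (B z * L).
Proof.
move=> fL z V _; apply: le_trans (_ : \sum_(x <- V) B z * (cmod (f x) * w x) <= _).
  apply: ler_sum => x _; rewrite !cmodM (cmodR_ge0 (w_ge0 x)) -mulrA.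
  by rewrite ler_wpM2r// mulr_ge0 ?cmod_ge0.
by rewrite -mulr_sumr ler_wpM2l// (le_trans (cmod_ge0 (K z z))).
Qed.

Lemma row_bounded_summable p f : 1 <= p -> Lp w p%:E f -> kernel_summable w K f.
Proof.
move=> p1 fp z; have p0 : 0 < p by lra.
have [L [L0 _ fL]] := Lp_bound w_gt0 p0 fp.
exists (B z * (D * w o + L `^ p)); apply: row_bounded_L1 => V.
have := Lp_sub tree ler01 p1 fL V.
by under eq_bigr do rewrite powRr1 ?cmod_ge0//.
Qed.

End RowBounded.

Local Notation m S := (fine (mass w S)).

Lemma mass_fin S : mass w S \is a fin_num.
Proof.
rewrite ge0_fin_numE ?esum_ge0// => [|x _]; last by rewrite lee_fin.
apply: le_lt_trans (ltry (D * w o)); apply: esum_le_fset => V _.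
exact: total_mass tree V.
Qed.

Lemma sum_mass S V : [set` V] `<=` S -> \sum_(x <- V) w x <= m S.
Proof. by move=> VS; rewrite -lee_fin fineK ?mass_fin//; exact: esum_ge_fset. Qed.

Lemma mass_gt0 S v : S v -> 0 < m S.
Proof.
move=> Sv; apply: lt_le_trans (w_gt0 v) _; rewrite -(big_seq_fset1 +%R v w).
by apply: sum_mass => x /=; rewrite in_fset1 => /eqP ->.
Qed.

Lemma mass_ge0 S : 0 <= m S.
Proof. by rewrite fine_ge0// esum_ge0// => x _; rewrite lee_fin. Qed.

Lemma sum_support S V (h : X -> R) : (forall x, ~ S x -> h x = 0) ->
  \sum_(x <- V) h x = \sum_(x <- [fset x in V | `[< S x >]]%fset) h x.
Proof.
move=> h0; rewrite -big_fset_condE/= (bigID (fun x => `[< S x >]))/=.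
by rewrite [X in _ + X]big1 ?addr0// => x /asboolPn; exact: h0.
Qed.

Lemma sub_support S V : [set` [fset x in V | `[< S x >]]%fset] `<=` S.
Proof. by move=> x /=; rewrite !inE/= => /andP[_ /asboolP]. Qed.

Lemma sum_support_le S f L V : 0 <= L -> (forall x, ~ S x -> f x = 0) ->
  (forall x, cmod (f x) <= L) -> \sum_(x <- V) cmod (f x) * w x <= L * m S.
Proof.
move=> L0 f0 fL; rewrite (sum_support (S := S)) => [|x /f0 ->]; last first.
  by rewrite cmod0 mul0r.
apply: le_trans (ler_wpM2l L0 (sum_mass (@sub_support S V))).
by rewrite mulr_sumr; apply: ler_sum => x _; rewrite ler_wpM2r.
Qed.

Lemma sum_support_sqr_le S f L V : 0 <= L -> (forall x, ~ S x -> f x = 0) ->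
  (forall x, cmod (f x) <= L) ->
  \sum_(x <- V) cmod (f x) ^+ 2 * w x <= L ^+ 2 * m S.
Proof.
move=> L0 f0 fL; apply: le_trans (_ : \sum_(x <- V) L * (cmod (f x) * w x) <= _).
  by apply: ler_sum => x _; rewrite expr2 -mulrA ler_wpM2r ?mulr_ge0 ?cmod_ge0.
rewrite -mulr_sumr expr2 -mulrA ler_wpM2l//; exact: sum_support_le.
Qed.

Variable A : R.
Hypothesis A_ge0 : 0 <= A.
Hypothesis L2 : L2_bounded w K A.

Lemma bounded_summable f L : 0 <= L -> (forall x, cmod (f x) <= L) ->
  kernel_summable w K f.
Proof.
move=> L0 fL; have [] // := L2 (f := f) (B := L ^+ 2 * m [set: X]).
  by rewrite mulr_ge0 ?sqr_ge0 ?mass_ge0.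
by move=> V; apply: sum_support_sqr_le => // x /(_ Logic.I).
Qed.

(* [t <= t^2 / L + L] replaces the Cauchy-Schwarz inequality. *)
Lemma near_bound S f L V : 0 < L -> (forall x, ~ S x -> f x = 0) ->
  (forall x, cmod (f x) <= L) -> [set` V] `<=` S ->
  \sum_(z <- V) cmod (kernel_op w K f z) * w z <= (A + 1) * L * m S.
Proof.
move=> L0 f0 fL VS; have [] := L2 (f := f) (B := L ^+ 2 * m S).
- by rewrite mulr_ge0 ?sqr_ge0 ?mass_ge0.
- by move=> U; apply: sum_support_sqr_le => //; exact: ltW.
move=> _ /(_ V) KV.
apply: le_trans (_ : \sum_(z <- V) (L^-1 * (cmod (kernel_op w K f z) ^+ 2 * w z)
    + L * w z) <= _).
  apply: ler_sum => z _; rewrite mulrA -mulrDl ler_wpM2r//.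
  set t := cmod _; have t0 : 0 <= t by exact: cmod_ge0.
  case: (leP t L) => tL; first by rewrite ler_wpDl// mulr_ge0 ?sqr_ge0 ?invr_ge0 ?(ltW L0).
  rewrite ler_wpDr ?(ltW L0)// expr2 mulrA ler_peMl// mulrC ler_pdivlMr// mul1r.
  exact: ltW.
rewrite big_split/= -!mulr_sumr !mulrDl mul1r lerD//; last first.
  by rewrite ler_wpM2l ?sum_mass ?(ltW L0).
apply: le_trans (ler_wpM2l _ KV) _; first by rewrite invr_ge0 (ltW L0).
by rewrite le_eqVlt; apply/orP; left; apply/eqP; field; rewrite gt_eqF.
Qed.

Lemma is_csum_setT S f s : (forall x, ~ S x -> f x = 0) -> is_csum S f s ->
  is_csum [set: X] f s.
Proof.
move=> f0 fs e e0; have [U US UP] := fs e e0; exists U => // V _ UV.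
have h0 : \sum_(x <- V | ~~ `[< S x >]) f x = 0.
  by rewrite big1// => x /asboolPn; exact: f0.
rewrite (bigID (fun x => `[< S x >]))/= h0 addr0 big_fset_condE/=.
apply: UP; first exact: sub_support.
by apply/fsubsetP => x xU; rewrite !inE/= (fsubsetP UV x xU); apply/asboolP/US.
Qed.

(** Treats singletons and sectors alike; for a singleton the differences vanish. *)
Definition hormander_set (N : X -> X -> R[i]) H S v : Prop :=
  S v /\ forall x Z, S x -> [set` Z] `<=` ~` S ->
    \sum_(z <- Z) cmod (N z x - N z v) * w z <= H.

(** Mean zero allows K(z,v) to be subtracted from the kernel. The factor 2 is the 2^p of
    [is_csum_Lp] at p = 1. *)
Lemma far_bound H S v f L Z : 0 <= H -> hormander_set K H S v -> 0 <= L ->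
  (forall x, ~ S x -> f x = 0) -> (forall x, cmod (f x) <= L) ->
  wsum w S f = 0 -> [set` Z] `<=` ~` S ->
  \sum_(z <- Z) cmod (kernel_op w K f z) * w z <= 2 * (H * (L * m S)).
Proof.
move=> H0 [Sv hS] L0 f0 fL mean0 ZS.
have fs := bounded_summable L0 fL.
have fw0 : is_csum [set: X] (fun x => f x * (w x)%:C) 0.
  apply: (@is_csum_setT S) => [x /f0 ->|]; first by rewrite mul0r.
  rewrite -mean0; apply: (@is_csum_csum _ _ _ _ (L * m S)) => V _.
  rewrite (eq_bigr (fun x => cmod (f x) * w x)); last first.
    by move=> x _; rewrite cmodM (cmodR_ge0 (w_ge0 x)).
  exact: sum_support_le.
have cs z : is_csum [set: X] (fun x => (K z x - K z v) * f x * (w x)%:C)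
    (kernel_op w K f z).
  have := is_csum_lin (- K z v) fw0 (kernel_op_is_csum z fs).
  rewrite mulr0 add0r; apply: is_csum_ext => x _; ring.
have := @is_csum_Lp R X X Z [set: X] _ _ w 1 (H * (L * m S)) ltr01 w_ge0 cs.
rewrite powRr1//; under eq_bigr do rewrite powRr1 ?cmod_ge0//.
apply=> U _; exists U; split=> //.
apply: le_trans (_ : \sum_(z <- Z) \sum_(x <- U)
   (cmod (K z x - K z v) * w z) * (cmod (f x) * w x) <= _).
  apply: ler_sum => z _; rewrite powRr1 ?cmod_ge0//.
  apply: le_trans (ler_wpM2r (w_ge0 z) (cmod_sum _ _ _)) _.
  rewrite mulr_suml; apply: ler_sum => x _.
  rewrite !cmodM (cmodR_ge0 (w_ge0 x)) le_eqVlt; apply/orP; left; apply/eqP; ring.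
rewrite exchange_big/=.
apply: le_trans (_ : \sum_(x <- U) H * (cmod (f x) * w x) <= _); last first.
  by rewrite -mulr_sumr ler_wpM2l// sum_support_le.
apply: ler_sum => x _; rewrite -mulr_suml.
have [Sx|Sx] := pselect (S x); last by rewrite f0// cmod0 mul0r !mulr0.
by rewrite ler_wpM2r ?mulr_ge0 ?cmod_ge0// hS.
Qed.

(** * From the Hardy space to L^1 *)

Section Hardy.
Variables (DD : set (set X)) (H : R).
Hypothesis H_ge0 : 0 <= H.
Hypothesis hDD : forall S, DD S -> exists v, hormander_set K H S v.

(** The bound 1 / m(S) of the atom cancels the mass of its set: [A + 1] comes from [S], [2 * H] from
    outside. The constant atom lives on the whole space and has no far part. *)
Lemma atom_image a Z : atom w DD a ->
  \sum_(z <- Z) cmod (kernel_op w K a z) * w z <= A + 1 + 2 * H.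
Proof.
have AH : A + 1 <= A + 1 + 2 * H by rewrite lerDl mulr_ge0.
case=> [ac|[S DS [a0 aL mean0]]].
  have mX : 0 < m [set: X] by exact: (@mass_gt0 _ o).
  have := @near_bound [set: X] a (m [set: X])^-1 Z.
  rewrite invr_gt0 -mulrA mulVf ?gt_eqF// mulr1 => h.
  apply: le_trans AH; apply: h => // x; first by move=> /(_ Logic.I).
  by rewrite ac cmodR_ge0// invr_ge0 ltW.
have [v hS] := hDD DS; have mS : 0 < m S by exact: mass_gt0 hS.1.
have {}aL : forall x, cmod (a x) <= (m S)^-1 by apply/(@Lpnorm_oo_leP _ _ w).
have iS : 0 < (m S)^-1 by rewrite invr_gt0.
rewrite (bigID (fun x => `[< S x >]))/= lerD//.
  rewrite big_fset_condE/=.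
  have := near_bound iS a0 aL (@sub_support S Z).
  by rewrite -mulrA mulVf ?gt_eqF// mulr1.
rewrite big_fset_condE/=.
have := far_bound H_ge0 hS (ltW iS) a0 aL mean0
  (Z := [fset x in Z | ~~ `[< S x >]]%fset).
rewrite mulVf ?gt_eqF// mulr1; apply.
by move=> x /=; rewrite !inE/= => /andP[_ /asboolPn].
Qed.

Lemma atom_bounded a : atom w DD a -> exists2 L, 0 <= L & forall x, cmod (a x) <= L.
Proof.
case=> [ac|[S DS [a0 aL mean0]]].
  exists (m [set: X])^-1 => [|x]; first by rewrite invr_ge0 mass_ge0.
  by rewrite ac cmodR_ge0// invr_ge0 mass_ge0.
exists (m S)^-1; first by rewrite invr_ge0 mass_ge0.
by apply/(@Lpnorm_oo_leP _ _ w).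
Qed.

Variable B : X -> R.
Hypothesis KB : forall z x, cmod (K z x) <= B z.

(** Split g into n terms of the series and a remainder, whose image at z is at most [B z] times its
    L^1 norm. For fixed finite [Z] this tends to zero, and the final bound no longer involves
    [B]. *)
Lemma atomic_image g lam a Z : Lp w 1%E g -> atomic_decomposition w DD g lam a ->
  \sum_(z <- Z) cmod (kernel_op w K g z) * w z <=
  (A + 1 + 2 * H) * fine (\sum_(0 <= j <oo) (cmod (lam j))%:E)%E.
Proof.
move=> g1 [aat lamfin cvg]; set C := A + 1 + 2 * H.
have C0 : 0 <= C by rewrite !addr_ge0// mulr_ge0.
pose r n x := g x - \sum_(0 <= j < n) lam j * a j x.
have gs : kernel_summable w K g by exact: row_bounded_summable KB _ _ _ g1.
have as_ j : kernel_summable w K (a j).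
  by have [L L0 aL] := atom_bounded (aat j); exact: bounded_summable aL.
have rS n : r n.+1 = (fun x => - lam n * a n x + r n x).
  by apply/funext => x; rewrite /r big_nat_recr//=; ring.
have r0 : r 0%N = g by apply/funext => x; rewrite /r big_geq// subr0.
have rs n : kernel_summable w K (r n).
  by elim: n => [|n IH]; [rewrite r0|rewrite rS; exact: kernel_summable_lin].
have step n : \sum_(z <- Z) cmod (kernel_op w K g z) * w z <=
    \sum_(z <- Z) cmod (kernel_op w K (r n) z) * w z +
    C * \sum_(0 <= j < n) cmod (lam j).
  elim: n => [|n IH]; first by rewrite r0 big_geq// mulr0 addr0.
  apply: le_trans IH _; rewrite big_nat_recr// mulrDr addrCA addrC lerD2r.
  apply: le_trans (_ : \sum_(z <- Z) (cmod (kernel_op w K (r n.+1) z) * w z +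
     cmod (lam n) * (cmod (kernel_op w K (a n) z) * w z)) <= _).
    apply: ler_sum => z _; rewrite mulrA -mulrDl ler_wpM2r//.
    rewrite rS (kernel_op_lin (- lam n) (as_ n) (rs n)) -cmodM.
    set p := lam n * _; set s := kernel_op _ _ _ z.
    rewrite mulNr -/p; apply: le_trans (_ : cmod ((- p + s) + p) <= _).
      by rewrite addrAC addNr add0r.
    exact: cmodD.
  rewrite big_split -mulr_sumr; apply: lerD => //.
  by rewrite mulrC ler_wpM2r ?cmod_ge0// atom_image.
set Lam := (\sum_(0 <= j <oo) _)%E in lamfin *.
have Lam0 : (0 <= Lam)%E by apply: nneseries_ge0 => j _ _; rewrite lee_fin cmod_ge0.
have LamF : Lam \is a fin_num by rewrite ge0_fin_numE.
have part n : \sum_(0 <= j < n) cmod (lam j) <= fine Lam.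
  rewrite -lee_fin fineK// -sumEFin.
  by apply: nneseries_lim_ge => j _ _; rewrite lee_fin cmod_ge0.
set BZ := \sum_(z <- Z) B z * w z.
have BZ0 : 0 <= BZ.
  rewrite sumr_ge0// => z _; rewrite mulr_ge0//.
  exact: le_trans (cmod_ge0 (K z z)) (KB z z).
have rest n L : 0 <= L -> (Lpnorm w 1%E (r n) <= L%:E)%E ->
    \sum_(z <- Z) cmod (kernel_op w K (r n) z) * w z <= BZ * L.
  move=> L0 /Lpnorm1_leP => /(_ w_gt0 L0) rL.
  rewrite mulr_suml; apply: ler_sum => z _; rewrite mulrAC ler_wpM2r//.
  apply: is_csum_le_bounded (kernel_op_is_csum z (rs n)) _.
  exact: row_bounded_L1.
apply/ler_addgt0Pr => e e0; rewrite addrC.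
have B1 : 0 < BZ + 1 by rewrite ltr_wpDl.
have e1 : 0 < e / (BZ + 1) by rewrite divr_gt0.
have [n rn] : exists n, (Lpnorm w 1%E (r n) <= (e / (BZ + 1))%:E)%E.
  have U : nbhs (0%E : \bar R) [set t | (t < (e / (BZ + 1))%:E)%E].
    apply: open_nbhs_nbhs; split; first exact: open_ereal_lt_ereal.
    by rewrite /= lte_fin.
  by have [n _ /(_ n (leqnn n)) rn] := cvg _ U; exists n; exact: ltW.
apply: le_trans (step n) _; rewrite lerD ?ler_wpM2l//.
apply: le_trans (rest n _ (ltW e1) rn) _.
by rewrite mulrA ler_pdivrMr// mulrC ler_wpM2l ?(ltW e0)// lerDl.
Qed.

Lemma extends_bounded_H1 :
  extends_bounded w K (H1 w DD) (Lp w 1%E) (H1norm w DD) (Lpnorm w 1%E).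
Proof.
set C := A + 1 + 2 * H.
have C0 : 0 < C by rewrite ltr_pwDl ?mulr_ge0// ltr_wpDl.
have bound g lam a : Lp w 1%E g -> atomic_decomposition w DD g lam a ->
    (Lpnorm w 1%E (kernel_op w K g) <=
     (C * fine (\sum_(0 <= j <oo) (cmod (lam j))%:E))%:E)%E.
  move=> g1 ga; apply/Lpnorm1_leP => //.
    rewrite mulr_ge0 ?(ltW C0)// fine_ge0// nneseries_ge0// => j _ _.
    by rewrite lee_fin cmod_ge0.
  by move=> V; exact: atomic_image ga.
exists (kernel_op w K) => //; split.
- by move=> g [g1 [lam [a ga]]]; exact: le_lt_trans (bound _ _ _ g1 ga) (ltry _).
- move=> c f g [f1 _] [g1 _]; apply: kernel_op_lin.
    exact: row_bounded_summable KB _ _ _ f1.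
  exact: row_bounded_summable KB _ _ _ g1.
(* The estimate holds for every decomposition, so after division by [C] the infimum can be taken. *)
exists C => g [g1 _]; rewrite -lee_pdivrMl//.
apply: le_ereal_inf_tmp => _ [lam [a [ga ->]]]; rewrite lee_pdivrMl//.
apply: le_trans (bound _ _ _ g1 ga) _; rewrite EFinM.
have [_ fin _] := ga; rewrite fineK// ge0_fin_numE//.
by apply: nneseries_ge0 => j _ _; rewrite lee_fin cmod_ge0.
Qed.

End Hardy.

(** * From L^infinity to BMO *)

Section BoundedMeanOscillation.
Variables (DD : set (set X)) (H : R).
Hypothesis H_ge0 : 0 <= H.
Hypothesis hDD : forall S, DD S -> exists v,
  hormander_set (adjoint_kernel K) H S v.

(** The constant is the value at [v] of the image of the part of [f] outside [S]. On [S] that image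
    varies from it by at most [H * L], by the condition on the adjoint kernel; [near_bound] handles
    the part inside [S]. *)
Lemma oscillation_bound S v f L : hormander_set (adjoint_kernel K) H S v ->
  0 < L -> (forall x, cmod (f x) <= L) ->
  exists c, forall V, [set` V] `<=` S ->
    \sum_(z <- V) cmod (kernel_op w K f z - c) * w z <= (A + 1 + H) * L * m S.
Proof.
move=> [Sv hS] L0 fL.
pose f1 x := if `[< S x >] then f x else 0.
pose f2 x := if `[< S x >] then 0 else f x.
have f1L x : cmod (f1 x) <= L by rewrite /f1; case: ifP => _ //; rewrite cmod0 ltW.
have f2L x : cmod (f2 x) <= L by rewrite /f2; case: ifP => _ //; rewrite cmod0 ltW.
have f1S x : ~ S x -> f1 x = 0 by move=> /asboolPn Sx; rewrite /f1 (negbTE Sx).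
have f2S x : S x -> f2 x = 0 by move=> /asboolP Sx; rewrite /f2 Sx.
have s1 := bounded_summable (ltW L0) f1L.
have s2 := bounded_summable (ltW L0) f2L.
have fE : f = (fun x => 1 * f1 x + f2 x).
  by apply/funext => x; rewrite mul1r /f1 /f2; case: ifP => _; rewrite ?addr0 ?add0r.
have KE z : kernel_op w K f z = kernel_op w K f1 z + kernel_op w K f2 z.
  by rewrite fE (kernel_op_lin 1 s1 s2) mul1r.
exists (kernel_op w K f2 v) => V VS.
have far z : S z -> cmod (kernel_op w K f2 z - kernel_op w K f2 v) <= H * L.
  move=> Sz.
  have cs := is_csum_lin (- 1) (kernel_op_is_csum v s2) (kernel_op_is_csum z s2).
  rewrite (_ : _ - _ = - 1 * kernel_op w K f2 v + kernel_op w K f2 z); last by ring.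
  apply: is_csum_le_bounded cs _ => U _.
  apply: le_trans (_ : \sum_(x <- U) L * (if `[< S x >] then 0 else
      cmod (adjoint_kernel K x z - adjoint_kernel K x v) * w x) <= _).
    apply: ler_sum => x _.
    have -> : - 1 * (K v x * f2 x * (w x)%:C) + K z x * f2 x * (w x)%:C =
       (K z x - K v x) * f2 x * (w x)%:C by ring.
    rewrite /f2; case: ifP => _; first by rewrite mulr0 mul0r cmod0 mulr0.
    rewrite !cmodM (cmodR_ge0 (w_ge0 x)) mulrA ler_wpM2r//.
    have -> : adjoint_kernel K x z - adjoint_kernel K x v = (K z x - K v x)^*.
      by rewrite /adjoint_kernel rmorphB.
    by rewrite cmodJ mulrC ler_wpM2r ?cmod_ge0.
  rewrite -mulr_sumr mulrC ler_wpM2r ?(ltW L0)//.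
  pose F x := cmod (adjoint_kernel K x z - adjoint_kernel K x v) * w x.
  have -> : \sum_(x <- U) (if `[< S x >] then 0 else F x) =
      \sum_(x <- [fset x in U | ~~ `[< S x >]]%fset) F x.
    rewrite -big_fset_condE/= [RHS]big_mkcond; apply: eq_bigr => x _.
    by rewrite if_neg.
  by apply: hS => // x /=; rewrite !inE/= => /andP[_ /asboolPn].
apply: le_trans (_ : \sum_(z <- V) (cmod (kernel_op w K f1 z) * w z + H * L * w z) <= _).
  rewrite big_seq [leRHS]big_seq; apply: ler_sum => z zV; rewrite -mulrDl ler_wpM2r//.
  rewrite KE -addrA; apply: le_trans (cmodD _ _) _.
  by rewrite lerD2l far//; exact: VS.
have -> : (A + 1 + H) * L * m S = (A + 1) * L * m S + H * L * m S by ring.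
rewrite big_split -mulr_sumr; apply: lerD; first exact: near_bound L0 f1S f1L VS.
by rewrite ler_wpM2l ?mulr_ge0 ?(ltW L0) ?sum_mass.
Qed.

Lemma average_deviation S v f (c : R[i]) (C : R) : S v ->
  (exists B, sums_bounded S (fun x => f x * (w x)%:C) B) ->
  (forall V, [set` V] `<=` S -> \sum_(z <- V) cmod (f z - c) * w z <= C * m S) ->
  cmod (c - average w S f) <= C.
Proof.
move=> Sv [B fB] cC; have mS := mass_gt0 Sv.
have mSn : m S != 0 by rewrite gt_eqF.
have cw : is_csum S (fun x => (w x)%:C) (m S)%:C.
  move=> e e0; have := @esum_approx R X S w e (fun x _ => w_ge0 x) _ e0.
  rewrite -ge0_fin_numE ?mass_fin; last by rewrite esum_ge0// => x _; rewrite lee_fin.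
  move=> /(_ isT)[U US UP]; exists U => // V VS UV.
  by rewrite -rmorph_sum -rmorphB cmodR; exact: UP.
have := is_csum_lin (- c) cw (is_csum_csum fB).
set s := csum _ _ => cs.
have le : cmod (- c * (m S)%:C + s) <= C * m S.
  apply: is_csum_le_bounded cs _ => V VS.
  rewrite (eq_bigr (fun z => cmod (f z - c) * w z)); first exact: cC.
  move=> x _; rewrite -[in RHS](cmodR_ge0 (w_ge0 x)) -cmodM; congr cmod; ring.
have -> : c - average w S f = - (((m S)^-1)%:C * (- c * (m S)%:C + s)).
  have k : ((m S)^-1)%:C * (m S)%:C = 1 :> R[i] by rewrite -rmorphM/= mulVf.
  rewrite /average /wsum -/s mulrDr mulrCA k; ring.
rewrite cmodN cmodM cmodR_ge0 ?invr_ge0 ?(ltW mS)//.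
by rewrite mulrC ler_pdivrMr.
Qed.

(** The 2 pays for replacing the constant of [oscillation_bound] by the average; the term with the
    total mass bounds the integral of the image through its L^1 norm. *)
Lemma BMO_bound f L : 0 < L -> (forall x, cmod (f x) <= L) ->
  (Lpnorm w 1%E (kernel_op w K f) <= ((A + 1) * L * m [set: X])%:E)%E /\
  (BMOnorm w DD (kernel_op w K f) <=
   ((2 * (A + 1 + H) + (A + 1) * m [set: X]) * L)%:E)%E.
Proof.
move=> L0 fL; set g := kernel_op w K f; set C := A + 1 + H.
have C0 : 0 <= C by rewrite !addr_ge0.
have A1 : 0 <= A + 1 by rewrite addr_ge0.
have g1 V : \sum_(z <- V) cmod (g z) * w z <= (A + 1) * L * m [set: X].
  by apply: near_bound => // x /(_ Logic.I).
have gb S : sums_bounded S (fun x => g x * (w x)%:C) ((A + 1) * L * m [set: X]).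
  move=> V _; have := g1 V; congr (_ <= _).
  by apply: eq_bigr => x _; rewrite cmodM (cmodR_ge0 (w_ge0 x)).
split.
  by apply/Lpnorm1_leP => //; rewrite !mulr_ge0 ?mass_ge0 ?(ltW L0).
rewrite mulrDl EFinD; apply: leeD.
  apply: ge_ereal_sup => _ [S DS <-].
  have [v hS] := hDD DS; have [c cC] := oscillation_bound hS L0 fL.
  have mS := mass_gt0 hS.1.
  have dev : cmod (c - average w S g) <= C * L.
    apply: (average_deviation hS.1) => //.
    by exists ((A + 1) * L * m [set: X]).
  rewrite lee_pdivrMl// -EFinM; apply: esum_le_fset => V VS.
  apply: le_trans (_ : \sum_(z <- V) (cmod (g z - c) * w z + C * L * w z) <= _).
    apply: ler_sum => z _; rewrite -mulrDl ler_wpM2r//.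
    rewrite -(subrK c (g z)) -addrA; apply: le_trans (cmodD _ _) _.
    by rewrite subrK lerD2l.
  rewrite big_split/= -mulr_sumr.
  apply: le_trans (lerD (cC V VS) (ler_wpM2l _ (sum_mass VS))) _.
    by rewrite mulr_ge0 ?(ltW L0).
  by rewrite le_eqVlt; apply/orP; left; apply/eqP; rewrite -/C; ring.
rewrite lee_fin /wsum.
have -> : (A + 1) * m [set: X] * L = (A + 1) * L * m [set: X] by ring.
exact: is_csum_le_bounded (is_csum_csum (gb _)) (gb _).
Qed.

Lemma extends_bounded_BMO :
  extends_bounded w K (Lp w +oo%E) (BMO w DD) (Lpnorm w +oo%E) (BMOnorm w DD).
Proof.
have Loo f : Lp w +oo%E f -> exists l, [/\ 0 <= l, Lpnorm w +oo%E f = l%:E &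
    forall x, cmod (f x) <= l].
  move=> foo; have n0 : (0 <= Lpnorm w +oo%E f)%E.
    apply: le_trans (_ : ((cmod (f o))%:E <= _)%E); first by rewrite lee_fin cmod_ge0.
    by apply: ereal_sup_ubound; exists o.
  have fin : Lpnorm w +oo%E f \is a fin_num by rewrite ge0_fin_numE.
  exists (fine (Lpnorm w +oo%E f)); split; [exact: fine_ge0|by rewrite fineK|].
  by apply/(@Lpnorm_oo_leP _ _ w); rewrite fineK.
set M := 2 * (A + 1 + H) + (A + 1) * m [set: X].
have M0 : 0 < M.
  rewrite ltr_pwDl ?mulr_ge0 ?mass_ge0 ?addr_ge0// mulr_gt0//.
  by rewrite ltr_pwDl// ltr_wpDl.
exists (kernel_op w K) => //; split.
- move=> f /Loo[l [l0 _ fl]].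
  have l1 : 0 < l + 1 by rewrite ltr_wpDl.
  have [|h1 h2] := @BMO_bound f (l + 1) l1.
    by move=> x; rewrite (le_trans (fl x))// lerDl.
  by split; [exact: le_lt_trans h1 (ltry _)|exact: le_lt_trans h2 (ltry _)].
- move=> c f g /Loo[l [l0 _ fl]] /Loo[k [k0 _ gk]].
  by apply: kernel_op_lin; [exact: bounded_summable fl|exact: bounded_summable gk].
exists M => f /Loo[l [l0 -> fl]]; rewrite -EFinM.
(* [BMO_bound] requires a strictly positive bound, while the supremum norm may be zero: use l + e /
   M and let e tend to zero. *)
apply/lee_addgt0Pr => e e0; rewrite -EFinD.
have eM : 0 < e / M by rewrite divr_gt0.
have [||_] := @BMO_bound f (l + e / M).
- by rewrite ltr_wpDl.
- by move=> x; rewrite (le_trans (fl x))// lerDl ltW.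
by rewrite -/M mulrDr [M * (e / M)]mulrC divfK ?gt_eqF.
Qed.

End BoundedMeanOscillation.

End Endpoints.

(** * From the Hoermander constant to finite sums *)

Section HormanderConstant.
Local Open Scope classical_set_scope.
Local Open Scope ring_scope.
Variables (R : realType) (X : choiceType) (adj : rel X) (o : X).
Variables (w : X -> R) (D : R).
Local Notation dep := (gdist adj o).
Local Notation par := (predecessor adj o).
Hypothesis tree : doubling_tree par dep o w D.
Implicit Types (K : X -> X -> R[i]).

Lemma hormander_constant_finite K :
  (hormander_constant w (sector adj o) o K < +oo)%E ->
  exists2 H, 0 <= H & finite_hormander par w K H.
Proof.
case: tree => rt w0 _ _; set h := hormander_constant _ _ _ _ => hfin.
have [H H0 hH] : exists2 H : R, 0 <= H & (h <= H%:E)%E.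
  case: h hfin => [r _||_] //; last by exists 0; rewrite ?leNye.
  by exists (Num.max 0 r); rewrite ?lee_fin le_max lexx ?orbT.
(* The constant only ranges over [v] other than [o]; the sector of [o] is the whole tree, so in that
   case [Z] is empty. *)
exists H => // v x Z vx Zv; have [vo|vo] := eqVneq v o.
  rewrite big_seq big1// => z zZ; exfalso.
  by apply: (Zv z zZ); rewrite vo; exact: descendants_root rt z.
rewrite -lee_fin; apply: le_trans hH.
apply: le_trans (@esum_ge_fset _ _ (~` descendants par v)
  (fun z => cmod (K z x - K z v) * w z) Z Zv) _.
apply: le_trans (ereal_sup_ubound _); last first.
  by exists v => //; exact/eqP.
apply: ereal_sup_ubound; exists (x, v) => //; split=> //=.
exact: descendants_refl.
Qed.

Lemma dyadic_hormander_set K H S : 0 <= H -> finite_hormander par w K H ->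
  dyadic adj o S -> exists v, hormander_set w K H S v.
Proof.
move=> H0 hK [v [->|->]]; exists v; split.
- by [].
- by move=> x Z -> _; rewrite big1// => z _; rewrite subrr cmod0 mul0r.
- exact: descendants_refl.
- by move=> x Z vx Zv; exact: hK.
Qed.

End HormanderConstant.

Section HomogeneousTreeDoubling.
Local Open Scope ring_scope.

(** The factor q^alpha compares the weight of a parent with that of its child; being at least 1, it
    does no harm in the first mass bound. *)
Lemma homogeneous_doubling (R : realType) (X : choiceType) (q : nat)
    (adj : rel X) (o : X) (alpha : R) :
  (2 <= q)%N -> homogeneous_tree q adj -> 1 < alpha ->
  doubling_tree (predecessor adj o) (gdist adj o) o (tree_weight q adj o alpha)
    (sector_const q alpha * q%:R `^ alpha).
Proof.
move=> q2 treeX a1; have s0 := sector_const_ge0 q2 a1.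
have w0 := tree_weight_gt0 adj o alpha q2.
split => //; first exact: (homogeneous_rooted o treeX).
  move=> v V Vv; apply: le_trans (sector_mass q2 treeX a1 Vv) _.
  rewrite -mulrA ler_wpM2l// ler_peMl ?(ltW (w0 v))//.
  have q1 : 1 <= q%:R :> R by rewrite ler1n (leq_trans _ q2).
  by have := ler_powR q1 (ltW (lt_trans ltr01 a1)); rewrite powRr0.
move=> v V Vv; apply: le_trans (sector_mass q2 treeX a1 Vv) _.
by rewrite -mulrA ler_wpM2l// tree_weight_par.
Qed.

End HomogeneousTreeDoubling.

Theorem theorem3 (R : realType) (q : nat) (q_ge2 : (2 <= q)%N)
    (X : choiceType) (adj : rel X) (treeX : homogeneous_tree q adj) (o : X)
    (alpha : R) (alpha_gt1 : (1 < alpha)%R) (K : X -> X -> complex R) :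
  let w := tree_weight q adj o alpha in
  let T := sector adj o in
  let DD := dyadic adj o in
  kernel_bounded_L2 w K ->
  ((hormander_constant w T o K < +oo)%E ->
     extends_bounded w K (H1 w DD) (Lp w 1%E) (H1norm w DD) (Lpnorm w 1%E) /\
     forall p : R, (1 < p)%R -> (p < 2)%R ->
       extends_bounded w K (Lp w p%:E) (Lp w p%:E)
         (Lpnorm w p%:E) (Lpnorm w p%:E)) /\
  ((hormander_constant w T o (adjoint_kernel K) < +oo)%E ->
     extends_bounded w K (Lp w +oo%E) (BMO w DD) (Lpnorm w +oo%E)
       (BMOnorm w DD) /\
     forall p : R, (2 < p)%R ->
       extends_bounded w K (Lp w p%:E) (Lp w p%:E)
         (Lpnorm w p%:E) (Lpnorm w p%:E)).
Proof.
move=> w T DD KL2.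
have tree := homogeneous_doubling o q_ge2 treeX alpha_gt1; rewrite -/w in tree.
set D := (sector_const q alpha * _)%R in tree.
have [A A0 L2] := kernel_bounded_L2_bounded tree KL2.
have tL2 := L2_bounded_truncated tree L2.
have sum_ge0 (V : {fset X}) (p : R) (f : X -> complex R) :
    (0 <= \sum_(x <- V) (cmod (f x) `^ p * w x))%R.
  apply: sumr_ge0 => x _; apply: mulr_ge0; first exact: powR_ge0.
  by case: tree => _ w_gt0 _ _; exact: (ltW (w_gt0 x)).
split=> /(hormander_constant_finite tree)[H H0 hK].
  have [B KB] := kernel_row_bounded tree (ltW A0) H0 tL2 hK.
  split.
    apply: (extends_bounded_H1 tree (ltW A0) L2 H0 _ KB) => S.
    exact: dyadic_hormander_set.
  move=> p p1 p2.
  (* The maximum with 0 gives a nonnegative constant without examining the sign of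
     [strong_const]. *)
  apply: (extends_bounded_Lp tree (C := Num.max 0%R (strong_const p D A H))).
  - exact: ltW.
  - by rewrite le_max lexx.
  - by move=> f; apply: (row_bounded_summable tree KB (ltW p1)).
  move=> f V oV clV; apply: le_trans
    (truncated_strong tree oV clV f p1 p2 (ltW A0) H0 tL2 hK) _.
  apply: ler_wpM2r; first exact: sum_ge0.
  by rewrite le_max lexx orbT.
split.
  apply: (extends_bounded_BMO tree (ltW A0) L2 H0) => S.
  exact: dyadic_hormander_set.
move=> p p2.
(* The maximum with 1 makes [C] positive, as the absorption in [fker_dual_Lp] requires. *)
set C := Num.max 1%R (strong_const (p / (p - 1))%R D A H).
have C0 : (0 < C)%R by rewrite lt_max ltr01.
apply: (extends_bounded_Lp tree (C := dual_const p C)).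
- by apply: ltW; apply: lt_trans p2; rewrite ltr1n.
- by rewrite mulr_ge0 ?powR_ge0.
- by move=> f; exact: (L2_bounded_summable tree (ltW p2) L2).
move=> f V oV clV; apply: (truncated_dual tree oV clV f p2 A0 H0 _ C0 tL2 hK).
by rewrite le_max lexx orbT.
Qed.
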